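(* Let $X$ be a Banach space and let $B\subseteq B_{X^{**}}$ be a James boundary for $X^*$. Then each of the following is equivalent to reflexivity of $X$ (and hence they are equivalent to each other). (a) Every $x^{**}\in B$ has a unique Hahn-Banach (norm-preserving linear) extension, as a functional on $X^*$, to $X^{***}$. (b) The identity $I:(B_{X^{**}},w^* )\to (B_{X^{**}},w)$ is continuous at every point of $\mathrm{ext}(B_{X^{**}})\cap NA_1(X^* )$. (c) The identity $I:(B_{X^{**}},w^* )\to (B_{X^{**}},w)$ is continuous on $B_{X^{**}}$.
   Context: For a Banach space $Z$, a set $B\subseteq B_{Z^*}$ is a James boundary of $Z$ if for every $z\in Z$ there exists $z^*\in B$ with $|z^*(z)|=\|z\|$. $NA_1(Z)$ is the set of norm-one functionals in $Z^*$ which attain their norm on the closed unit ball $B_Z$; thus $NA_1(X^* )\subseteq X^{**}$. $X^*$ is canonically embedded in $X^{***}$. $\mathrm{ext}(B_{X^{**}})$ denotes the set of extreme points of $B_{X^{**}}$. On $B_{X^{**}}$, $w^*$ is the relative weak-$*$ topology induced by $X^*$ and $w$ is the relative weak topology (induced by $X^{***}$). *)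

(* Defs.v *)
From HB Require Import structures.
From mathcomp Require Import all_boot all_order all_algebra.
From mathcomp Require Import all_classical all_reals all_analysis.
From mathcomp Require Import complex.

Set Implicit Arguments.
Unset Strict Implicit.
Unset Printing Implicit Defensive.

Import Order.TTheory GRing.Theory Num.Theory.
Import numFieldNormedType.Exports.

Local Open Scope classical_set_scope.
Local Open Scope ring_scope.

(* In R[i] the order only compares numbers with the same imaginary part, and
   norms are nonnegative elements of R[i]; bounded nonempty sets of
   nonnegative elements have suprema there.  This is what operator norms need,
   so duals can be built uniformly over R and R[i]. *)
HB.mixin Record NumField_hasNonnegSup K & Num.NumField K := {
  nonneg_supremums : forall A : set K,
    A !=set0 -> (forall a, A a -> 0 <= a) -> ubound A !=set0 ->
    supremums A !=set0
}.

#[short(type="scalarFieldType")]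
HB.structure Definition ScalarField :=
  {K of Num.NumField K & NumField_hasNonnegSup K}.

Lemma real_nonneg_supremums (R : realType) (A : set R) :
  A !=set0 -> (forall a, A a -> 0 <= a) -> ubound A !=set0 ->
  supremums A !=set0.
Proof.
move=> A0 _ Aub; have hA : has_sup A by [].
exists (sup A); split; first exact: sup_upper_bound.
by move=> y Ay; exact: ge_sup.
Qed.

#[non_forgetful_inheritance]
HB.instance Definition _ (R : realType) :=
  NumField_hasNonnegSup.Build R (@real_nonneg_supremums R).

Lemma complex_nonneg_supremums (R : realType) (A : set R[i]) :
  A !=set0 -> (forall a, A a -> 0 <= a) -> ubound A !=set0 ->
  supremums A !=set0.
Proof.
move=> [a Aa] A0 [M AM]; pose ReA := [set complex.Re z | z in A].
have hA : has_sup ReA.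
  split; first by exists (complex.Re a), a.
  by exists (complex.Re M) => _ [z Az <-]; have := AM _ Az; rewrite lecE => /andP[].
have ReK z : 0 <= z -> (real_complex R (complex.Re z)) = z.
  by move=> z0; apply: RRe_real; exact: ger0_real.
exists (real_complex R (sup ReA)); split.
  move=> z Az; rewrite -(ReK z (A0 _ Az)) lecR.
  by apply: sup_upper_bound => //; exists z.
move=> y Ay; have y0 : 0 <= y by exact: le_trans (A0 _ Aa) (Ay _ Aa).
rewrite -(ReK y y0) lecR; apply: ge_sup; first by case: hA.
by move=> _ [z Az <-]; have := Ay _ Az; rewrite lecE => /andP[].
Qed.

HB.instance Definition _ (R : realType) :=
  NumField_hasNonnegSup.Build R[i] (@complex_nonneg_supremums R).

Section Dual.
Variables (K : scalarFieldType) (X : normedModType K).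

Definition dual_pred : {pred X -> K^o} :=
  [pred f : X -> K^o | `[< linear f /\ continuous f >]].

Record dual := Dual {
  dual_fun :> X -> K^o;
  dual_funP : dual_fun \in dual_pred }.

HB.instance Definition _ := [isSub for dual_fun].
HB.instance Definition _ := [Choice of dual by <:].

Lemma dual_submod_closed : submod_closed dual_pred.
Proof.
split.
  apply/asboolP; split; first by move=> a u v; rewrite scaler0 addr0.
  exact: cst_continuous.
move=> a f g /asboolP[lf cf] /asboolP[lg cg]; apply/asboolP; split.
  move=> b u v; rewrite !fctE lf lg !scalerDr !scalerA (mulrC a b).
  by rewrite addrACA.
move=> x; apply: cvgD; last exact: cg.
by apply: cvgZl_tmp; exact: cf.
Qed.

HB.instance Definition _ :=
  GRing.isSubmodClosed.Build K (X -> K^o) dual_pred dual_submod_closed.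
HB.instance Definition _ := [SubChoice_isSubLmodule of dual by <:].

Lemma dual_linear (f : dual) : linear (f : X -> K^o).
Proof. by have /asboolP[] := dual_funP f. Qed.

HB.instance Definition _ (f : dual) :=
  GRing.isLinear.Build K X K^o *:%R f (dual_linear f).

Lemma dual_continuous (f : dual) : continuous (f : X -> K^o).
Proof. by have /asboolP[] := dual_funP f. Qed.

Definition dual_norm (f : dual) : K :=
  supremum 0 [set `|f x| | x in [set x : X | `|x| <= 1]].

Lemma dual_norm_supremums (f : dual) :
  supremums [set `|f x| | x in [set x : X | `|x| <= 1]] (dual_norm f).
Proof.
set A := [set `|f x| | x in _].
have A0 : A !=set0 by exists `|f 0|, 0 => //=; rewrite normr0.
have /linear_bounded_continuous := @dual_continuous f.
move=> /linear_boundedP/pinfty_ex_gt0[M M0 fM].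
have supA : supremums A !=set0.
  apply: nonneg_supremums => //; first by move=> _ [x _ <-].
  exists M => _ [x /= x1 <-]; apply: le_trans (fM x) _.
  by rewrite -[leRHS]mulr1 ler_pM2l.
rewrite /dual_norm /supremum -/A; case: ifPn => [/eqP A00|_].
  by case: A0 => x; rewrite A00.
by case: xgetP => [y -> //|nA]; case: supA => z /nA.
Qed.

Lemma dual_norm_ball (f : dual) (x : X) : `|x| <= 1 -> `|f x| <= dual_norm f.
Proof. by move=> x1; have [ub _] := dual_norm_supremums f; apply: ub; exists x. Qed.

Lemma dual_norm_lub (f : dual) (M : K) :
  (forall x : X, `|x| <= 1 -> `|f x| <= M) -> dual_norm f <= M.
Proof.
move=> fM; have [_ lb] := dual_norm_supremums f.
by apply: lb => _ [x /= x1 <-]; exact: fM.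
Qed.

Lemma dual_norm_ge0 (f : dual) : 0 <= dual_norm f.
Proof.
by apply: le_trans (@dual_norm_ball f 0 _); rewrite ?normr0 ?normr_ge0.
Qed.

Lemma dual_norm_le (f : dual) (x : X) : `|f x| <= dual_norm f * `|x|.
Proof.
have [->|x0] := eqVneq x 0; first by rewrite linear0 !normr0 mulr0.
have nx0 : 0 < `|x| by rewrite normr_gt0.
have := @dual_norm_ball f (`|x|^-1 *: x).
rewrite linearZ/= !normrZ normfV normr_id mulVf ?gt_eqF// => /(_ (lexx _)).
by rewrite ler_pdivrMl// mulrC.
Qed.

Lemma dual_norm_ler_normD (f g : dual) :
  dual_norm (f + g) <= dual_norm f + dual_norm g.
Proof.
apply: dual_norm_lub => x x1; apply: le_trans (ler_normD _ _) _.
by apply: lerD; exact: dual_norm_ball.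
Qed.

Lemma dual_normZ (a : K) (f : dual) : dual_norm (a *: f) = `|a| * dual_norm f.
Proof.
have le b g : dual_norm (b *: g) <= `|b| * dual_norm g.
  apply: dual_norm_lub => x x1; rewrite [X in `|X|](_ : _ = b *: g x)//.
  by rewrite normrZ ler_wpM2l//; exact: dual_norm_ball.
apply/le_anti; rewrite le /=; have [->|a0] := eqVneq a 0.
  by rewrite normr0 mul0r dual_norm_ge0.
rewrite -ler_pdivlMl ?normr_gt0// -normfV.
by rewrite -[in leLHS](scalerK a0 f); exact: le.
Qed.

Lemma dual_norm_eq0 (f : dual) : dual_norm f = 0 -> f = 0.
Proof.
move=> f0; apply/val_inj/funext => x /=; apply/normr0_eq0/le_anti.
by rewrite normr_ge0 andbT; have := dual_norm_le f x; rewrite f0 mul0r.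
Qed.

HB.instance Definition _ := @Lmodule_isNormed.Build K dual dual_norm
  dual_norm_ler_normD dual_normZ dual_norm_eq0.

End Dual.

Section Bidual.
Variables (K : scalarFieldType) (X : normedModType K).

Lemma canonical_embedding_subproof (x : X) :
  (fun f : dual X => f x : K^o) \in @dual_pred K (dual X).
Proof.
have lin : linear (fun f : dual X => f x : K^o) by [].
apply/asboolP; split=> //.
pose ev : {linear dual X -> K^o} := HB.pack (fun f : dual X => f x : K^o)
  (GRing.isLinear.Build K (dual X) K^o *:%R _ lin).
apply: (@bounded_linear_continuous K (dual X) K^o ev).
apply/linear_boundedP; near=> r => f /=.
apply: le_trans (dual_norm_le f x) _; rewrite mulrC ler_wpM2r ?dual_norm_ge0//.
Unshelve. all: by end_near. Qed.

Definition canonical_embedding (x : X) : dual (dual X) := Dual (canonical_embedding_subproof x).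

Definition reflexive_space : Prop :=
  forall phi : dual (dual X), exists x : X, canonical_embedding x = phi.

End Bidual.

Section Notions.
Variables (K : scalarFieldType).

Definition unit_ball (Z : normedModType K) : set Z := [set z | `|z| <= 1].
Arguments unit_ball : clear implicits.

Definition James_boundary (Z : normedModType K) (B : set (dual Z)) : Prop :=
  B `<=` unit_ball (dual Z) /\ forall z : Z, exists2 f : dual Z, B f & `|f z| = `|z|.

Definition NA1 (Z : normedModType K) : set (dual Z) :=
  [set f : dual Z | `|f| = 1 /\ exists2 z, unit_ball Z z & `|f z| = `|f|].
Arguments NA1 : clear implicits.

Definition extreme_points (Z : normedModType K) (A : set Z) : set Z :=
  [set z | A z /\ forall (x y : Z) (t : K), A x -> A y -> 0 < t < 1 ->
    z = t *: x + (1 - t) *: y -> x = z /\ y = z].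

(* A functional phi on Z is extended to the bidual of Z, in which Z sits
   through its canonical embedding. *)
Definition unique_Hahn_Banach_extension (Z : normedModType K) (phi : dual Z) :=
  exists! psi : dual (dual (dual Z)),
    (forall z : Z, psi (canonical_embedding z) = phi z) /\ `|psi| = `|phi|.

Definition weak (Z : normedModType K) : topologicalType :=
  initial_topology (fun z : Z => (fun f => f z) : {ptws dual Z -> K^o}).

Definition weak_star (Z : normedModType K) : topologicalType :=
  initial_topology (fun f : dual Z => (fun z => f z) : {ptws Z -> K^o}).

Definition dual_ball (Z : normedModType K) : Type :=
  {f : dual Z | `|f| <= 1}.

Definition dual_ball_weak (Z : normedModType K) : topologicalType :=
  initial_topology (fun f : dual_ball Z => val f : weak (dual Z)).

Definition dual_ball_weak_star (Z : normedModType K) : topologicalType :=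
  initial_topology (fun f : dual_ball Z => val f : weak_star Z).

Definition weak_star_to_weak (Z : normedModType K) :
  dual_ball_weak_star Z -> dual_ball_weak Z := fun f => f.

End Notions.

Arguments unit_ball {K} Z _.
Arguments NA1 {K} Z _.
Arguments weak_star_to_weak {K} Z _.

(* Main.v *)
From HB Require Import structures.
Require Import Defs.
From mathcomp Require Import all_boot all_order all_algebra.
From mathcomp Require Import all_classical all_reals all_analysis.
From mathcomp Require Import complex.
From mathcomp Require Import ring lra.
Import Order.TTheory GRing.Theory Num.Theory.
Import numFieldNormedType.Exports.
Local Open Scope classical_set_scope.
Local Open Scope ring_scope.

(* For phi in X**, both G |-> G phi and G |-> phi (G o J), where J : X -> X**, are
   norm-preserving extensions of phi to X***.  If they agree, every functional on
   X** that vanishes on J X vanishes at phi (Dixmier's projection), so phi lies in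
   J X because X is complete.  By Goldstine's theorem, weak*-to-weak
   continuity at phi has the same consequence.  Since every functional on X attains
   its norm at an extreme point of the bidual ball, (a), (b) and (c) each force
   every functional on X to attain its norm on the ball of X, and James' theorem
   applies.

   James' theorem: if X is not reflexive, Helly's theorem gives f_k in the ball of
   X* and x_j in the ball of X with f_k x_j >= th for k <= j and f_k x_j -> 0 for
   fixed j.  One builds sum_i (1 - q) q^i g_i - g_0, with g_i in the convex hull of
   the f_k and g_0 a cluster point of the g_i, so that its supremum is not
   attained.  As g_0 is unknown while the g_i are chosen, one keeps passing to
   infinite sets of indices k along which the relevant suprema no longer depend
   on the cluster point (Pryce).

   Hahn-Banach and the extreme points both come from Zorn's lemma applied to
   sublinear functions: a minimal one is linear. *)

Set Implicit Arguments.
Unset Strict Implicit.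
Unset Printing Implicit Defensive.

(** * A sequence of functions on a set *)

Section JamesSequence.
Variables (R : realType) (T : Type) (f : nat -> T -> R).
Implicit Types (N : set nat) (g h : T -> R).

Definition convex_pred (C : (T -> R) -> Prop) := forall g h t,
  0 <= t <= 1 -> C g -> C h -> C (fun x => t * g x + (1 - t) * h x).

(** The convex hull of the [f k] with [k] in [N], encoded impredicatively: a convex property of
    these [f k] passes to [g] by mere application, without finite sums. *)
Definition hull N g := forall C : (T -> R) -> Prop,
  convex_pred C -> (forall k, N k -> C (f k)) -> C g.

Definition unbounded_nat N := forall m, exists2 k, N k & (m <= k)%N.

(* The supremum of h - s * f0 over T is at most c, for every cluster point f0 of
   the f k with k in N. *)
Definition limsup_le N h s c := forall x e, 0 < e ->
  exists m, forall k, N k -> (m <= k)%N -> h x - s * f k x <= c + e.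

(* Passing to subsequences N' of N and picking g in the hull, one cannot bring the
   supremum of h + tau * g - f0 below a. *)
Definition value_ge N h tau a := forall N' g c, N' `<=` N -> unbounded_nat N' ->
  hull N g -> limsup_le N' (fun x => h x + tau * g x) 1 c -> a <= c.

Lemma hull_mem N k : N k -> hull N (f k).
Proof. by move=> Nk C _; apply. Qed.

Lemma hullS N N' g : N `<=` N' -> hull N g -> hull N' g.
Proof. by move=> NN' gN C cC CN; apply: (gN C) => // k Nk; apply: CN; exact: NN'. Qed.

Lemma hull_convex N : convex_pred (hull N).
Proof. by move=> g h t t01 gN hN C cC CN; exact: cC t01 (gN C cC CN) (hN C cC CN). Qed.

Lemma convex_affine_le x (b s c : R) :
  convex_pred (fun g => b - s * g x <= c).
Proof.
move=> g h t /andP[t0 t1] gc hc /=.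
have := ler_wpM2l t0 gc; have t1' : 0 <= 1 - t by lra.
have := ler_wpM2l t1' hc; lra.
Qed.

Lemma hull_affine_le N g x (b s c : R) :
  hull N g -> (forall k, N k -> b - s * f k x <= c) -> b - s * g x <= c.
Proof. by move=> gN H; apply: (gN _ (@convex_affine_le x b s c)). Qed.

Hypothesis f1 : forall k x, `|f k x| <= 1.

Lemma hull_norm N g x : hull N g -> `|g x| <= 1.
Proof.
move=> gN.
have H1 : 0 - 1 * g x <= 1.
  apply: hull_affine_le gN _ => k _; have := f1 k x; rewrite ler_norml => /andP[]; lra.
have H2 : 0 - -1 * g x <= 1.
  apply: hull_affine_le gN _ => k _; have := f1 k x; rewrite ler_norml => /andP[]; lra.
by rewrite ler_norml; apply/andP; split; lra.
Qed.

(** With [g] nearly optimal for the infimum [a'] of the values, the part [(1 - q) * tau] of the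
    weight [tau] is spent on [g] and [q * tau] is kept for later choices. Shrinking [N] makes the
    lower bound [a' - e] visible at one point [y]. *)
Lemma value_step (q th : R) N h tau a c n (e : R) :
  0 < q < 1 -> 0 < th < 1 -> 0 < tau <= 1 -> 0 < e -> unbounded_nat N ->
  limsup_le N h (1 - tau) c -> c < a * (1 - th * tau) -> value_ge N h tau a ->
  exists N' g a' c' y, [/\ N' `<=` [set k | N k /\ (n <= k)%N] , unbounded_nat N',
   hull N g, a <= a' &
   let h' x := h x + (1 - q) * tau * g x in
   [/\ limsup_le N' h' (1 - q * tau) c', c' < a' * (1 - th * (q * tau)),
      value_ge N' h' (q * tau) a' &
      forall k, N' k -> a' - e < h y + tau * g y - f k y]].
Proof.
move=> /andP[q0 q1] /andP[th0 th1] /andP[tau0 tau1] e0 Nub hc ca Na.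
pose A := [set c | exists N' g, [/\ N' `<=` N, unbounded_nat N', hull N g &
   limsup_le N' (fun x => h x + tau * g x) 1 c]].
have Aa : lbound A a by move=> d [N' [g []]]; exact: Na.
have A0 : A !=set0.
  have [k0 Nk0 _] := Nub 0%N.
  (* A single far index [l] gives [h x <= c + 2]; then [tau * f k0 x] and [- f k x] add at most 1
     each. *)
  exists (c + 4), N, (f k0); split => //; first exact: hull_mem.
  move=> x e' e'0; exists 0%N => k Nk _.
  have [m /= Hm] := hc x 1 ltr01; have [l Nl ml] := Nub m.
  have := Hm _ Nl ml.
  have := f1 k x; have := f1 l x; have := f1 k0 x; rewrite !ler_norml.
  move=> /andP[_ ?] /andP[? ?] /andP[? ?].
  have : tau * f k0 x <= 1 by nra.
  have : (1 - tau) * f l x <= 1 by nra.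
  lra.
pose a' := inf A.
have hasA : has_inf A by split => //; exists a.
have aa' : a <= a' by apply: lb_le_inf.
have thtau : th * tau <= 1 by nra.
have slack : 0 < a' * (1 - th * tau) - c.
  rewrite subr_gt0; apply: lt_le_trans ca _; rewrite ler_wpM2r //; lra.
(* The target [a' * (1 - th * (q * tau))] exceeds [q * c + (1 - q) * a'] by exactly [d], so the
   excess [(1 - q) * d] of [(1 - q) * c1] is affordable. *)
pose d := q * (a' * (1 - th * tau) - c).
have d0 : 0 < d by rewrite mulr_gt0.
have [c1 [N1 [g [N1N N1ub gN gc1]]] c1a] := inf_adherent d0 hasA.
(* Along a suitable subsequence, the supremum for N' exceeds a' - e at one point y
   for all cluster points simultaneously. *)
have gt_a' N' : N' `<=` N -> unbounded_nat N' -> exists y,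
    unbounded_nat [set k | N' k /\ a' - e < h y + tau * g y - f k y].
  move=> N'N N'ub; apply: contrapT => /forallNP HN.
  suff /(@ge_inf _ A)-/(_ hasA.2) : A (a' - e) by rewrite -/a'; lra.
  exists N', g; split => // x e' e'0.
  apply: contrapT => /forallNP Hm; apply: (HN x) => m.
  have := Hm m; move/existsNP => [k /not_implyP[Nk /not_implyP[mk /negP]]].
  by rewrite -ltNge mul1r => Hk; exists k => //; split => //; lra.
have [y Hy] := gt_a' _ N1N N1ub.
pose N2 := [set k | [/\ N1 k, a' - e < h y + tau * g y - f k y & (n <= k)%N]].
have N2N : N2 `<=` N by move=> k [/N1N].
(* [c'] comes from [h + (1 - q) * tau * g - (1 - q * tau) * f = q * (h - (1 - tau) * f) + (1 - q) *
   (h + tau * g - f)]. *)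
exists N2, g, a', (q * c + (1 - q) * c1), y; split => //.
- by move=> k [/N1N].
- move=> m; have [k [? ?]] := Hy (maxn n m); rewrite geq_max => /andP[? ?].
  by exists k.
split.
- move=> x e' e'0; have [m1 H1] := hc x _ e'0; have [m2 H2] := gc1 x _ e'0.
  exists (maxn m1 m2) => k [N1k _ _]; rewrite geq_max => /andP[mk1 mk2].
  have := H1 _ (N1N _ N1k) mk1; have := H2 _ N1k mk2.
  move=> /(ler_wpM2l (_ : 0 <= 1 - q)) -/(_ ltac:(lra)) I2.
  move=> /(ler_wpM2l (ltW q0)) I1; lra.
- rewrite /d in c1a; have : (1 - q) * c1 <= (1 - q) * (a' + d).
    by rewrite ler_wpM2l //; rewrite /d; lra.
  by have := mulr_gt0 q0 d0; rewrite /d; lra.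
- move=> N' g' c' N'N2 N'ub g'N2 Hc'.
  apply: (@ge_inf _ A) => //; first exact: hasA.2.
  (* [h' + q * tau * g'] is [h + tau * ((1 - q) * g + q * g')], so a later choice [g'] already
     competes in the infimum [a']. *)
  exists N', (fun x => (1 - q) * g x + (1 - (1 - q)) * g' x); split => //.
  + exact: subset_trans N'N2 N2N.
  + apply: hull_convex => //; last exact: hullS g'N2; apply/andP; split; lra.
  + move=> x e' /(Hc' x)[m Hm]; exists m => k Nk mk.
    have := Hm _ Nk mk; lra.
- by move=> k [].
Qed.

Record stage := Stage {
  gN : set nat; gh : T -> R; ga : R; gc : R; gn : nat }.

(** [value_step] is iterated with [tau] and the error both equal to [q ^+ n]; thus [h n] is the
    partial sum of the series of terms [(1 - q) * q ^+ i * g i]. *)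
Lemma stage_sequence (q th a0 : R) :
  0 < q < 1 -> 0 < th < 1 -> 0 < a0 -> value_ge setT (fun=> 0) 1 a0 ->
  exists (N : nat -> set nat) (h g : nat -> T -> R) (a c : nat -> R) (y : nat -> T),
  [/\ a 0%N = a0, forall x, h 0%N x = 0 & forall n, [/\
    N n.+1 `<=` [set k | N n k /\ (n < k)%N], hull (N n) (g n),
    a n <= a n.+1 &
    [/\ forall x, h n.+1 x = h n x + (1 - q) * q ^+ n * g n x,
        limsup_le (N n) (h n) (1 - q ^+ n) (c n), c n < a n * (1 - th * q ^+ n) &
        forall k, N n.+1 k ->
          a n.+1 - q ^+ n < h n (y n) + q ^+ n * g n (y n) - f k (y n)]]].
Proof.
move=> q01 th01 a00 v0; have /andP[q0 q1] := q01; have /andP[th0 th1] := th01.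
pose inv (s : stage) := [/\ unbounded_nat (gN s),
  limsup_le (gN s) (gh s) (1 - q ^+ gn s) (gc s),
  gc s < ga s * (1 - th * q ^+ gn s) & value_ge (gN s) (gh s) (q ^+ gn s) (ga s)].
pose rel (s s' : {s : stage | inv s}) := let s := sval s in let s' := sval s' in
  [/\ gn s' = (gn s).+1, gN s' `<=` [set k | gN s k /\ (gn s < k)%N], ga s <= ga s' &
   exists gy : (T -> R) * T, let g := gy.1 in let y := gy.2 in [/\ hull (gN s) g,
     gh s' = (fun x => gh s x + (1 - q) * q ^+ gn s * g x) &
     forall k, gN s' k ->
      ga s' - q ^+ gn s < gh s y + q ^+ gn s * g y - f k y]].
have i0 : inv (Stage setT (fun=> 0) a0 0 0%N).
  split => //=; first by move=> m; exists m.
  - by move=> x e e0; exists 0%N => k _ _; rewrite expr0; lra.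
  - by rewrite expr0 mulr1 mulr_gt0 ?subr_gt0.
have [s|s [s0 Hs]] := @dependent_choice _ rel _ (exist _ _ i0).
  apply: cid; case: s => -[N h a c n] /= ist; have [/= Nub Hh ca Hv] := ist.
  have qn : 0 < q ^+ n <= 1 by rewrite exprn_gt0 ?exprn_ile1 // ltW.
  have qn0 : 0 < q ^+ n by case/andP: qn.
  have [N' [g [a' [c' [y [N'N N'ub gN aa' [/= H1 H2 H3 H4]]]]]]] :=
    value_step n.+1 q01 th01 qn qn0 Nub Hh ca Hv.
  have ist' : inv (Stage N' (fun x => h x + (1 - q) * q ^+ n * g x) a' c' n.+1).
    by split => //=; rewrite exprS.
  by exists (exist _ _ ist'); split => //=; exists (g, y); split.
have gnE n : gn (sval (s n)) = n.
  by elim: n => [|n IH]; [rewrite s0|have [-> _ _ _] := Hs n; rewrite IH].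
have Hgy n : {gy : (T -> R) * T | let g := gy.1 in let y := gy.2 in
     [/\ hull (gN (sval (s n))) g,
     gh (sval (s n.+1)) = (fun x => gh (sval (s n)) x + (1 - q) * q ^+ n * g x) &
     forall k, gN (sval (s n.+1)) k -> ga (sval (s n.+1)) - q ^+ n <
        gh (sval (s n)) y + q ^+ n * g y - f k y]}.
  by apply: cid; have [_ _ _] := Hs n; rewrite gnE.
exists (fun n => gN (sval (s n))), (fun n => gh (sval (s n))),
  (fun n => (sval (Hgy n)).1),
  (fun n => ga (sval (s n))), (fun n => gc (sval (s n))), (fun n => (sval (Hgy n)).2).
split; [by rewrite s0|by move=> x; rewrite s0|move=> n].
have [_ + ? _] := Hs n; rewrite gnE => NN.
have := svalP (s n); rewrite /inv gnE => -[? ? ? _].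
have /= [? hE ?] := svalP (Hgy n).
by split => //; split => // x; exact: (congr1 (@^~ x) hE).
Qed.

(** Weaker than a cluster point for pointwise convergence, since only one [x] is tested at a time;
    the index [m] is however common to [g] and [h]. *)
Definition cluster_pair (g h : nat -> T -> R) (g0 h0 : T -> R) :=
  forall x e M, 0 < e -> exists m, [/\ (M <= m)%N,
    `|g m x - g0 x| < e & `|h m x - h0 x| < e].

(** If [h0 - g0] had a maximum [M] at [x], then [a n <= M] for all [n], while stage [n] bounds
    [h n x - (1 - q ^+ n) * g0 x] by [M * (1 - th * q ^+ n)]. Comparing with [M = h0 x - g0 x] keeps
    every [g n x] away from [g0 x], against [g0] being a cluster point. *)
Lemma no_maximum (th : R) : 0 < th < 1 -> value_ge setT (fun=> 0) 1 th ->
  exists g h : nat -> T -> R, [/\ forall n, hull setT (g n),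
    forall n, exists s g', [/\ 0 <= s <= 1, hull setT g' & forall x, h n x = s * g' x] &
    forall g0 h0, cluster_pair g h g0 h0 ->
    ~ exists x, forall y, h0 y - g0 y <= h0 x - g0 x].
Proof.
move=> th01 v0; have /andP[th0 th1] := th01.
(* Chosen so that the loss [2 * q] in [gap] below is half of [th ^+ 2]. *)
pose q := th ^+ 2 / 4.
have /andP[t0 t1] : 0 < th ^+ 2 < 1 by rewrite exprn_gt0 // exprn_ilt1 // ltW.
have q01 : 0 < q < 1.
  rewrite /q; apply/andP; split; first by rewrite divr_gt0.
  by rewrite ltr_pdivrMr // mul1r; apply: lt_trans t1 _; rewrite ltr1n.
have /andP[q0 q1] := q01.
have [N [h [g [a [c [y [a0 h0 H]]]]]]] := stage_sequence q01 th01 th0 v0.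
have qn0 n : 0 < q ^+ n by rewrite exprn_gt0.
have qn1 n : q ^+ n <= 1 by rewrite exprn_ile1 // ltW.
have Ndecr n m : (n <= m)%N -> N m `<=` N n.
  move=> /subnK <-; elim: (m - n)%N => // d IH; apply: subset_trans IH.
  by have [NS _ _ _] := H (d + n)%N; rewrite addSn => k /NS[].
have Nge n : N n `<=` [set k | (n <= k)%N].
  by case: n => // n; have [NS _ _ _] := H n => k /NS[].
have adecr n m : (n <= m)%N -> a n <= a m.
  move=> /subnK <-; elim: (m - n)%N => // d IH; apply: le_trans IH _.
  by have [_ _ aS _] := H (d + n)%N; rewrite addSn.
have gT n : hull setT (g n) by have [_ + _ _] := H n; apply: hullS.
have g1 n x : `|g n x| <= 1 by apply: hull_norm (gT n).
have hS n x : h n.+1 x = h n x + (1 - q) * q ^+ n * g n x.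
  by have [_ _ _ [+ _ _ _]] := H n; apply.
have hdist n m x : (n <= m)%N -> `|h m x - h n x| <= q ^+ n - q ^+ m.
  move=> /subnK <-; elim: (m - n)%N => [|d IH]; first by rewrite !subrr normr0.
  rewrite addSn hS exprS; set m' := (d + n)%N in IH *.
  have B0 : 0 <= (1 - q) * q ^+ m' by rewrite mulr_ge0 ?subr_ge0 ?ltW.
  have : `|(1 - q) * q ^+ m' * g m' x| <= (1 - q) * q ^+ m'.
    by rewrite normrM ger0_norm // -[leRHS]mulr1 ler_wpM2l.
  move: IH; rewrite !ler_norml => /andP[? ?] /andP[? ?]; apply/andP; split; lra.
exists g, h; split => //.
  (* The weights [(1 - q) * q ^+ i] with [i < n] add up to [1 - q ^+ n]. *)
  move=> n; have [g' g'T hE] : exists2 g', hull setT g' &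
      forall x, h n x = (1 - q ^+ n) * g' x.
    elim: n => [|n [g' g'T IH]].
      by exists (f 0%N) => [|x]; [exact: hull_mem|rewrite h0 expr0 subrr mul0r].
    have qS : 0 < 1 - q ^+ n.+1 by rewrite subr_gt0 exprn_ilt1 // ltW.
    exists (fun x => (1 - q ^+ n) / (1 - q ^+ n.+1) * g' x +
       (1 - (1 - q ^+ n) / (1 - q ^+ n.+1)) * g n x).
      apply: hull_convex => //; rewrite divr_ge0 ?(ltW qS) ?subr_ge0 //=.
      by rewrite ler_pdivrMr // mul1r exprS; have := qn0 n; nra.
    move=> x; rewrite hS IH; move: qS; rewrite exprS => /lt0r_neq0 qS.
    by field.
  by exists (1 - q ^+ n), g'; split => //; rewrite subr_ge0 qn1 gerBl ltW.
move=> g0 hinf gh [x xmax].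
set M := hinf x - g0 x in xmax.
(* At [y m] stage [m] nearly reaches [a m.+1]. Passing to [hinf - g0] there loses [3 * q ^+ m]: the
   slack of the stage, the term [q ^+ m * g m], and the distance from [h m] to a later [h l]. *)
have aM n : a n <= M.
  apply/ler_addgt0Pr => e e0.
  have [m nm me] : exists2 m, (n <= m)%N & 3 * q ^+ m < e.
    have q1' : `|q| < 1 by rewrite ger0_norm // ltW.
    have /cvgrPdist_lt/(_ (e / 3)) := cvg_expr q1'.
    rewrite divr_gt0 // => /(_ isT)[k _ Hk]; exists (maxn n k); first exact: leq_maxl.
    have := Hk _ (leq_maxr n k); rewrite sub0r normrN ger0_norm ?(ltW (qn0 _)) //.
    by lra.
  have [_ _ aS [_ _ _ Hy]] := H m.
  set z := y m in Hy.
  have d0 : 0 < (e - 3 * q ^+ m) / 2 by lra.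
  have [l [ml]] := gh z _ m.+1 d0.
  rewrite !ltr_distl => /andP[G1 G2] /andP[H1 H2].
  have hl : hull (N m.+1) (g l).
    by have [_ + _ _] := H l; apply: hullS; exact: Ndecr.
  have : 0 - -1 * g l z <= h m z + q ^+ m * g m z - (a m.+1 - q ^+ m).
    by apply: hull_affine_le hl _ => k /Hy; lra.
  have := hdist _ _ z (ltnW ml); rewrite ler_norml => /andP[? ?].
  have := xmax z; have := adecr _ _ nm.
  have := g1 m z; rewrite ler_norml => /andP[? ?].
  have : q ^+ m * g m z <= q ^+ m by have := qn0 m; nra.
  have := qn0 l; lra.
have thM : th <= M by rewrite -a0.
(* The bound [c n] passes from the [f k] to their hull, hence to [g l] for large [l], and from there
   to the cluster point [g0]. *)
have hc n : h n x - (1 - q ^+ n) * g0 x <= c n.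
  apply/ler_addgt0Pr => e e0; have e2 : 0 < e / 2 by lra.
  have [_ _ _ [_ Hc _ _]] := H n.
  have [m Hm] := Hc x _ e2.
  have [l [ml]] := gh x _ (maxn m n) e2; move: ml; rewrite geq_max => /andP[ml nl].
  rewrite !ltr_distl => /andP[G1 G2] _.
  have : h n x - (1 - q ^+ n) * g l x <= c n + e / 2.
    have [_ hl _ _] := H l; apply: hull_affine_le hl _ => k Nk.
    by apply: Hm; [exact: Ndecr Nk|exact: leq_trans ml (Nge _ _ Nk)].
  have := mulr_gt0 (qn0 n) e2.
  have : (1 - q ^+ n) * (g l x - g0 x) <= (1 - q ^+ n) * (e / 2).
    by rewrite ler_wpM2l ?subr_ge0 //; lra.
  by lra.
have hinfle n : hinf x <= h n x + (1 - q) * q ^+ n * g n x + q ^+ n.+1.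
  rewrite -hS; apply/ler_addgt0Pr => e e0.
  have [l [nl]] := gh x _ n.+1 e0; rewrite !ltr_distl => _ /andP[? ?].
  have := hdist _ _ x nl; have := qn0 l; rewrite ler_norml => ? /andP[? ?]; lra.
(* From [hinfle], [hc] and [c n < M * (1 - th * q ^+ n)], division by [q ^+ n] gives
   [M * th <= (1 - q) * g n x + q - g0 x]. *)
have gap n : th ^+ 2 / 2 <= g n x - g0 x.
  have [_ _ _ [_ _ + _]] := H n; have := hc n; have := hinfle n; rewrite -/M => ? ? ?.
  have ? : a n * (1 - th * q ^+ n) <= M * (1 - th * q ^+ n).
    by rewrite ler_wpM2r // subr_ge0; have := qn0 n; have := qn1 n; nra.
  have : q ^+ n * (M * th) <= q ^+ n * ((1 - q) * g n x + q - g0 x).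
    by have ME : M = hinf x - g0 x by []; move: (hinfle n); rewrite exprS; lra.
  rewrite ler_pM2l // => ?.
  have ? : th ^+ 2 <= M * th by rewrite expr2; nra.
  have := g1 n x; rewrite ler_norml => /andP[? ?].
  have : - (q * g n x) <= q by nra.
  have qE : q = th ^+ 2 / 4 by [].
  lra.
have e0 : 0 < th ^+ 2 / 2 by lra.
have [m [_ + _]] := gh x _ 0%N e0; rewrite ltr_distl => /andP[_].
have := gap m; lra.
Qed.

(** A convex combination of the [f k] is at least [th] at [x j] for all large [j], whereas cluster
    points of the [f k] are at most 0 at each [x j]. *)
Lemma value_ge_separated (th : R) (x : nat -> T) :
  (forall j e, 0 < e -> exists m, forall k, (m <= k)%N -> f k (x j) <= e) ->
  (forall k j, (k <= j)%N -> th <= f k (x j)) ->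
  value_ge setT (fun=> 0) 1 th.
Proof.
move=> fx0 fxth N g c _ Nub gT Hc; apply/ler_addgt0Pr => e e0.
have e2 : 0 < e / 2 by lra.
have [j Hj] : exists j, th <= g (x j).
  suff [m Hm] : exists m, forall j, (m <= j)%N -> th <= g (x j) by exists m; exact: Hm.
  apply: (gT (fun g => exists m, forall j, (m <= j)%N -> th <= g (x j))) =>
    [g1 g2 t /andP[t0 t1] [m1 H1] [m2 H2]|k _]; last by exists k => j; exact: fxth.
  exists (maxn m1 m2) => j; rewrite geq_max => /andP[/H1 g1j /H2 g2j].
  have := ler_wpM2l t0 g1j; have := ler_wpM2l (_ : 0 <= 1 - t) g2j.
  by rewrite subr_ge0 t1 => /(_ isT); lra.
have [m Hm] := Hc (x j) _ e2; have [m' Hm'] := fx0 j _ e2.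
have [k Nk] := Nub (maxn m m'); rewrite geq_max => /andP[mk m'k].
by have := Hm _ Nk mk; have := Hm' _ m'k; lra.
Qed.

End JamesSequence.

(** * Sublinear functions *)

(* What the proof needs to know of the scalar fields R and R[i]; complexify is
   F x = u x - i u (i x) in the complex case. *)
Record real_part (R : realType) (K : scalarFieldType) := RealPart {
  re : K -> R;
  of_re : {rmorphism R -> K};
  reD : forall a b, re (a + b) = re a + re b;
  re_ofM : forall r z, re (of_re r * z) = r * re z;
  of_re_norm : forall z : K, of_re (re `|z|) = `|z|;
  re_le_norm : forall z : K, re z <= re `|z|;
  of_re_le : forall r s, (of_re r <= of_re s) = (r <= s);
  complexify : forall (E : lmodType K) (u : E -> R),
    (forall x y, u (x + y) = u x + u y) ->
    (forall r x, u (of_re r *: x) = r * u x) ->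
    exists2 F : E -> K^o, linear F & forall x, re (F x) = u x }.

Section ExtremeDominated.
Variables (R : realType) (K : scalarFieldType) (rp : real_part R K).
Variable (E : lmodType K).
Implicit Types (q l : E -> R) (u v e : E).
Local Notation "r %:K" := (of_re rp r) (at level 2, format "r %:K").

Definition real_linear l :=
  (forall u v, l (u + v) = l u + l v) /\ (forall r v, l (r%:K *: v) = r * l v).

Definition sublinear q :=
  (forall u v, q (u + v) <= q u + q v) /\
  (forall r v, 0 <= r -> q (r%:K *: v) <= r * q v).

Lemma sublinear0 q : sublinear q -> q 0 = 0.
Proof.
move=> [qD qZ]; apply/le_anti/andP; split.
  by have := qZ 0 0 (lexx _); rewrite scaler0 mul0r.
by have := qD 0 0; rewrite addr0; lra.
Qed.

Lemma sublinearZ q r v : sublinear q -> 0 <= r -> q (r%:K *: v) = r * q v.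
Proof.
move=> sq r0; have [qD qZ] := sq; apply/le_anti; rewrite qZ //=.
have [<-|rn0] := eqVneq 0 r; first by rewrite rmorph0 scale0r mul0r sublinear0.
have rp0 : 0 < r by rewrite lt_def eq_sym rn0.
have := qZ r^-1 (r%:K *: v); rewrite invr_ge0 r0 => /(_ isT).
rewrite scalerA -rmorphM mulVf 1?eq_sym // rmorph1 scale1r => H.
by rewrite -ler_pdivlMl.
Qed.

Lemma sublinear_opp q v : sublinear q -> - q (- v) <= q v.
Proof. by move=> sq; have := sq.1 v (- v); rewrite subrr sublinear0 //; lra. Qed.

Lemma real_linearN l v : real_linear l -> l (- v) = - l v.
Proof.
by move=> [_ lZ]; have := lZ (-1) v; rewrite rmorphN1 scaleN1r mulN1r.
Qed.

Lemma real_linear_le_eq l1 l2 : real_linear l1 -> real_linear l2 ->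
  (forall v, l1 v <= l2 v) -> forall v, l1 v = l2 v.
Proof.
move=> r1 r2 l12 v; apply/le_anti; rewrite l12 /=.
by have := l12 (- v); rewrite !real_linearN // lerN2.
Qed.

Definition push_set q e v := [set q (v + t%:K *: e) - t * q e | t in [set t | 0 <= t]].

(* It defines the face of {l <= q} where l e = q e. *)
Definition push q e v := inf (push_set q e v).

Lemma push_lb q e v : sublinear q -> lbound (push_set q e v) (- q (- v)).
Proof.
move=> sq _ [t /= t0 <-].
have := sq.1 (v + t%:K *: e) (- v); rewrite addrAC subrr add0r sublinearZ //.
by lra.
Qed.

Lemma push_le q e v t : sublinear q -> 0 <= t ->
  push q e v <= q (v + t%:K *: e) - t * q e.
Proof.
by move=> sq t0; apply: ge_inf; [exists (- q (- v)); exact: push_lb|exists t].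
Qed.

Lemma le_push q e v a : (forall t, 0 <= t -> a <= q (v + t%:K *: e) - t * q e) ->
  a <= push q e v.
Proof.
move=> H; apply: lb_le_inf; last by move=> _ [t /= t0 <-]; exact: H.
by exists (q (v + 0%:K *: e) - 0 * q e), 0 => //=.
Qed.

Lemma push_sublinear q e : sublinear q -> sublinear (push q e).
Proof.
move=> sq; split.
  move=> u v; rewrite -lerBlDr; apply: le_push => t t0.
  rewrite lerBlDr [leRHS]addrC -lerBlDr; apply: le_push => s s0.
  have st : 0 <= s + t by rewrite addr_ge0.
  have := push_le e (u + v) sq st.
  rewrite (_ : u + v + _ = (u + t%:K *: e) + (v + s%:K *: e)); last first.
    by rewrite rmorphD scalerDl [X in _ + X = _]addrC addrACA.
  have := sq.1 (u + t%:K *: e) (v + s%:K *: e); lra.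
move=> r v r0; have [<-|rn0] := eqVneq 0 r.
  have := push_le e 0 sq (lexx 0).
  by rewrite rmorph0 !scale0r addr0 !mul0r (sublinear0 sq) subr0.
have rp0 : 0 < r by rewrite lt_def eq_sym rn0.
rewrite -ler_pdivrMl //; apply: le_push => t t0.
rewrite ler_pdivrMl //; have rt0 : 0 <= r * t by rewrite mulr_ge0.
apply: le_trans (push_le e _ sq rt0) _.
by rewrite rmorphM -scalerA -scalerDr sublinearZ // mulrBr mulrA.
Qed.

Lemma push_le_self q e v : sublinear q -> push q e v <= q v.
Proof.
move=> sq; have := push_le e v sq (lexx 0).
by rewrite rmorph0 scale0r addr0 mul0r subr0.
Qed.

Lemma push_opp q e : sublinear q -> push q e (- e) <= - q e.
Proof.
move=> sq; have := push_le e (- e) sq ler01.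
by rewrite rmorph1 scale1r addNr mul1r sublinear0 // sub0r.
Qed.

(* {l <= q} is a face of {l <= p}. *)
Definition face p q := forall l1 l2 t, real_linear l1 -> real_linear l2 ->
  (forall v, l1 v <= p v) -> (forall v, l2 v <= p v) -> 0 < t < 1 ->
  (forall v, t * l1 v + (1 - t) * l2 v <= q v) ->
  (forall v, l1 v <= q v) /\ (forall v, l2 v <= q v).

(** At [- e], [push_opp] forces [t * l1 e + (1 - t) * l2 e >= q e], so [l1] and [l2] both agree with
    [q] at [e]; a linear [l <= q] with [l e = q e] lies below [push q e]. *)
Lemma push_face p q e : sublinear q -> face p q -> face p (push q e).
Proof.
move=> sq fq l1 l2 t r1 r2 p1 p2 t01 lp.
have [l1q l2q] : (forall v, l1 v <= q v) /\ (forall v, l2 v <= q v).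
  by apply: fq t01 _ => // v; apply: le_trans (lp v) _; exact: push_le_self.
have le_pushl l : real_linear l -> (forall v, l v <= q v) -> l e = q e ->
    forall v, l v <= push q e v.
  move=> rl lq le v; apply: le_push => s s0.
  by have := lq (v + s%:K *: e); rewrite rl.1 rl.2 le; lra.
have /andP[t0 t1] := t01.
have := le_trans (lp (- e)) (push_opp e sq); rewrite !real_linearN // => H.
have := l1q e; have := l2q e => q2 q1.
split; apply: le_pushl => //; apply/le_anti/andP; split => //; nra.
Qed.

(* A sublinear function that is minimal among those defining a face of {l <= p} is
   linear, since it coincides with all its pushes; its face is then a point. *)
Lemma extreme_dominated p e0 : sublinear p -> exists l, [/\ real_linear l,
  forall v, l v <= p v, l e0 = p e0 &
  forall l1 l2 t, real_linear l1 -> real_linear l2 ->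
  (forall v, l1 v <= p v) -> (forall v, l2 v <= p v) -> 0 < t < 1 ->
  (forall v, l v = t * l1 v + (1 - t) * l2 v) -> l1 =1 l /\ l2 =1 l].
Proof.
move=> sp.
(* The condition at [- e0] forces [l e0 >= p e0] for every linear [l <= q]. *)
pose good q := [/\ sublinear q, forall v, q v <= p v, q (- e0) <= - p e0 & face p q].
have good0 : good (push p e0).
  split; [exact: push_sublinear|by move=> v; exact: push_le_self|exact: push_opp|].
  by apply: push_face => // l1 l2.
(* The order is reversed, so that the maximal element from Zorn's lemma is a minimal sublinear
   function. *)
pose below (q q' : {q | good q}) := `[< forall v, sval q' v <= sval q v >].
have [||||[q gq] qmax] := @Zorn {q | good q} below.
- by move=> q; apply/asboolP.
- move=> q1 q2 q3 /asboolP H1 /asboolP H2; apply/asboolP => v.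
  exact: le_trans (H2 v) (H1 v).
- move=> [q1 g1] [q2 g2] /asboolP H1 /asboolP H2; apply/eq_exist/funext => v.
  by apply/le_anti; rewrite H1 H2.
- move=> A Atot; have [A0|/set0P[q0 Aq0]] := eqVneq A set0.
    by exists (exist _ _ good0) => s; rewrite A0.
  pose S v := [set sval q v | q in A].
  have Slb v : lbound (S v) (- p (- v)).
    move=> _ [[q [sq qp _ _]] /= _ <-].
    by apply: le_trans (sublinear_opp v sq); rewrite lerN2.
  have S0 v : S v !=set0 by exists (sval q0 v), q0.
  pose qi v := inf (S v).
  have qi_le v s : A s -> qi v <= sval s v.
    by move=> As; apply: ge_inf; [exists (- p (- v))|exists s].
  have le_qi v a : (forall s, A s -> a <= sval s v) -> a <= qi v.
    by move=> H; apply: lb_le_inf => // _ [s As <-]; exact: H.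
  have gqi : good qi.
    split.
    + split.
        move=> u v; rewrite -lerBlDr; apply/le_qi => q1 A1.
        rewrite lerBlDr [leRHS]addrC -lerBlDr; apply/le_qi => q2 A2.
        have [/asboolP H|/asboolP H] := Atot _ _ A1 A2.
          have [[qD _] _ _ _] := svalP q2.
          by have := qi_le (u + v) _ A2; have := qD u v; have := H u; lra.
        have [[qD _] _ _ _] := svalP q1.
        by have := qi_le (u + v) _ A1; have := qD u v; have := H v; lra.
      move=> r v r0; have [<-|rn0] := eqVneq 0 r.
        have [sq _ _ _] := svalP q0; have := qi_le (0%:K *: v) _ Aq0.
        by rewrite rmorph0 scale0r (sublinear0 sq) mul0r.
      have rp0 : 0 < r by rewrite lt_def eq_sym rn0.
      rewrite -ler_pdivrMl //; apply: le_qi => s As; rewrite ler_pdivrMl //.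
      have [sq _ _ _] := svalP s.
      by rewrite -sublinearZ //; exact: qi_le.
    + by move=> v; have [_ qp _ _] := svalP q0; apply: le_trans (qp v); exact: qi_le.
    + by have [_ _ qe _] := svalP q0; apply: le_trans qe; exact: qi_le.
    + move=> l1 l2 t r1 r2 p1 p2 t01 H.
      suff Hq s : A s -> (forall v, l1 v <= sval s v) /\ (forall v, l2 v <= sval s v).
        by split=> v; apply: le_qi => q /Hq[].
      move=> As; have [_ _ _ fq] := svalP s; apply: fq t01 _ => // v.
      by apply: le_trans (H v) _; exact: qi_le.
  by exists (exist _ _ gqi) => q Aq; apply/asboolP => v /=; exact: qi_le.
have [sq qp qe fq] := gq.
have qN v : q (- v) = - q v.
  have gpush : good (push q v).
    split; [exact: push_sublinear| | |].
    - by move=> w; apply: le_trans (qp w); exact: push_le_self.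
    - by apply: le_trans qe; exact: push_le_self.
    - exact: push_face.
  have /(congr1 sval)/= pq : exist _ _ gpush = exist _ _ gq.
    by apply: qmax; apply/asboolP => w /=; exact: push_le_self.
  apply/le_anti/andP; split; first by have := push_opp v sq; rewrite pq.
  by have := sublinear_opp (- v) sq; rewrite opprK; lra.
have rq : real_linear q.
  split=> [u v|r v].
    apply/le_anti; rewrite sq.1 /=.
    by have := sq.1 (u + v) (- v); rewrite addrK qN; lra.
  have [r0|r0] := leP 0 r; first exact: sublinearZ.
  rewrite -[r in LHS]opprK rmorphN scaleNr qN sublinearZ ?mulNr ?opprK //.
  by rewrite oppr_ge0 ltW.
exists q; split=> //.
  by apply/le_anti; rewrite qp /=; move: qe; rewrite qN lerN2.
move=> l1 l2 t r1 r2 p1 p2 t01 H.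
have [l1q l2q] : (forall v, l1 v <= q v) /\ (forall v, l2 v <= q v).
  by apply: fq t01 _ => // v; rewrite H.
by split; apply: real_linear_le_eq.
Qed.

End ExtremeDominated.

(** * Real parts of functionals *)

Section RealNorm.
Variables (R : realType) (K : scalarFieldType) (rp : real_part R K).
Local Notation "r %:K" := (of_re rp r) (at level 2, format "r %:K").
Local Notation re := (re rp).
Local Notation real_linear := (real_linear rp).
Local Notation sublinear := (sublinear rp).

(** Norms take values in [K]; the underlying real number is open to [inf] and to real arithmetic. *)
Definition rnorm (V : normedModType K) (x : V) : R := re `|x|.

Lemma re0 : re 0 = 0.
Proof. by have := reD rp 0 0; rewrite addr0; lra. Qed.

Lemma reN z : re (- z) = - re z.
Proof. by have := reD rp z (- z); rewrite subrr re0; lra. Qed.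

Lemma reB a b : re (a - b) = re a - re b.
Proof. by rewrite reD reN. Qed.

Lemma of_re_norm_r (r : R) : `|r%:K| = `|r|%:K.
Proof.
have [r0|r0] := leP 0 r.
  by rewrite !ger0_norm // -(rmorph0 (of_re rp)) of_re_le.
have rK0 : r%:K < 0.
  by rewrite lt_neqAle fmorph_eq0 lt_eqF //= -[0](rmorph0 (of_re rp)) of_re_le ltW.
by rewrite !ltr0_norm ?rmorphN.
Qed.

Lemma of_rnorm (V : normedModType K) (x : V) : (rnorm x)%:K = `|x|.
Proof. by rewrite /rnorm -[`|x|]normr_id of_re_norm. Qed.

Lemma rnorm_lt_of (V : normedModType K) (x : V) r : (`|x| < r%:K) = (rnorm x < r).
Proof.
rewrite !lt_neqAle -[`|x|]of_rnorm of_re_le; congr (~~ _ && _).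
by apply/eqP/eqP => [/fmorph_inj|->].
Qed.

Lemma rnorm_le (V W : normedModType K) (x : V) (y : W) :
  (`|x| <= `|y|) = (rnorm x <= rnorm y).
Proof. by rewrite -(of_re_le rp) !of_rnorm. Qed.

Lemma rnorm_le_of (V : normedModType K) (x : V) r : (`|x| <= r%:K) = (rnorm x <= r).
Proof. by rewrite -(of_re_le rp) of_rnorm. Qed.

Lemma rnorm_ball (V : normedModType K) (x : V) : (`|x| <= 1) = (rnorm x <= 1).
Proof. by rewrite -rnorm_le_of rmorph1. Qed.

Lemma rnorm_ge0 (V : normedModType K) (x : V) : 0 <= rnorm x.
Proof. by rewrite -(of_re_le rp) of_rnorm rmorph0. Qed.

Lemma rnormD (V : normedModType K) (x y : V) : rnorm (x + y) <= rnorm x + rnorm y.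
Proof. by rewrite -(of_re_le rp) rmorphD !of_rnorm ler_normD. Qed.

Lemma rnormZ (V : normedModType K) (a : K) (x : V) :
  rnorm (a *: x) = rnorm (a : K^o) * rnorm x.
Proof. by apply: (fmorph_inj (of_re rp)); rewrite rmorphM !of_rnorm normrZ. Qed.

Lemma rnorm_of_re (r : R) : rnorm (r%:K : K^o) = `|r|.
Proof. by apply: (fmorph_inj (of_re rp)); rewrite of_rnorm of_re_norm_r. Qed.

Lemma rnormZr (V : normedModType K) (r : R) (x : V) :
  rnorm (r%:K *: x) = `|r| * rnorm x.
Proof. by rewrite rnormZ rnorm_of_re. Qed.

Lemma rnorm0 (V : normedModType K) : rnorm (0 : V) = 0.
Proof. by rewrite /rnorm normr0 re0. Qed.

Lemma rnormN (V : normedModType K) (x : V) : rnorm (- x) = rnorm x.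
Proof. by rewrite /rnorm normrN. Qed.

Lemma rnorm_eq0 (V : normedModType K) (x : V) : rnorm x = 0 -> x = 0.
Proof. by move=> x0; apply/normr0_eq0; rewrite -of_rnorm x0 rmorph0. Qed.

Lemma rnormM (a b : K^o) : rnorm (a * b : K^o) = rnorm a * rnorm b.
Proof. exact: (rnormZ (V := K^o)). Qed.

Lemma re_le_rnorm (z : K^o) : re z <= rnorm z.
Proof. exact: re_le_norm. Qed.

Lemma rnorm_sublinear (V : normedModType K) : sublinear (@rnorm V).
Proof.
split; first exact: rnormD.
by move=> r v r0; rewrite rnormZr ger0_norm.
Qed.

Lemma pos_of_re (e : K) : 0 < e -> 0 < re e /\ e = (re e)%:K.
Proof.
move=> e0; have eE : e = (re e)%:K.
  by rewrite -[e in RHS]gtr0_norm // of_re_norm gtr0_norm.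
split => //; rewrite lt_neqAle -(of_re_le rp) -eE rmorph0 ltW // andbT.
by apply: contraTneq e0 => re0; rewrite eE -re0 rmorph0 ltxx.
Qed.

Section DualRe.
Variable X : normedModType K.
Implicit Types (F G : dual X).

Lemma re_dual_linear F : real_linear (fun x => re (F x)).
Proof.
split=> [x y|r x]; first by rewrite linearD reD.
by rewrite linearZ /= re_ofM.
Qed.

Lemma rnorm_dual F x : rnorm (F x) <= rnorm F * rnorm x.
Proof.
rewrite -(of_re_le rp) rmorphM !of_rnorm; exact: dual_norm_le.
Qed.

Lemma re_dual_le F x : re (F x) <= rnorm F * rnorm x.
Proof. exact: le_trans (re_le_rnorm _) (rnorm_dual _ _). Qed.

(** Turns a bound on [re F] over a ball into a bound on the modulus of [F]: [c] cancels the phase of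
    [F x]. *)
Lemma rotate (V : lmodType K) (F : V -> K^o) (x : V) : scalable F ->
  exists2 c : K, `|c| <= 1 & F (c *: x) = `|F x|.
Proof.
move=> FZ; have [F0|F0] := eqVneq (F x) 0.
  by exists 1; rewrite ?normr1 // scale1r F0 normr0.
exists (`|F x| / F x); first by rewrite normrM normr_id normfV mulfV ?normr_eq0.
by rewrite FZ; exact: divfK.
Qed.

Lemma dual_rnorm_le F (C : R) :
  0 <= C -> (forall x, re (F x) <= C * rnorm x) -> rnorm F <= C.
Proof.
move=> C0 FC; rewrite -rnorm_le_of; apply: dual_norm_lub => x x1.
have [c c1 Fc] := rotate x (linearZ_LR F).
rewrite rnorm_le_of /rnorm -Fc; apply: le_trans (FC _) _.
rewrite -[leRHS]mulr1 ler_wpM2l // -rnorm_ball normrZ.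
by rewrite -[leRHS]mulr1 ler_pM.
Qed.

Lemma dual_of_re u (C : R) : 0 <= C -> real_linear u -> (forall x, u x <= C * rnorm x) ->
  exists2 F : dual X, rnorm F <= C & forall x, re (F x) = u x.
Proof.
move=> C0 [uD uZ] uC.
have [f lf fu] := complexify uD uZ.
pose f' : {linear X -> K^o} := HB.pack f (GRing.isLinear.Build K X K^o *:%R f lf).
have fC x : `|f x| <= C%:K * `|x|.
  have [c c1 Fc] := rotate x (linearZ_LR f').
  rewrite -[`|x|]of_rnorm -rmorphM rnorm_le_of /rnorm -[`|f x|]Fc fu.
  apply: le_trans (uC _) _; rewrite ler_wpM2l // -rnorm_le normrZ.
  by rewrite -[leRHS]mul1r ler_wpM2r.
have cf : continuous (f : X -> K^o).
  apply: (@bounded_linear_continuous K X K^o f').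
  apply/linear_boundedP; near=> r => x /=.
  apply: le_trans (fC x) _; rewrite ler_wpM2r //.
  by near: r; apply: nbhs_pinfty_ge; rewrite realE -(rmorph0 (of_re rp)) !of_re_le C0.
have fP : f \in @dual_pred K X by apply/asboolP.
exists (Dual fP) => //; apply: dual_rnorm_le => // x /=.
by rewrite fu.
Unshelve. all: by end_near. Qed.

Lemma dual_re_eq F G : (forall x, re (F x) = re (G x)) -> F = G.
Proof.
move=> FG; apply/eqP; rewrite -subr_eq0; apply/eqP/rnorm_eq0/le_anti.
rewrite rnorm_ge0 andbT; apply: dual_rnorm_le => // x.
by rewrite [X in re X](_ : _ = F x - G x) // reB FG subrr mul0r.
Qed.

End DualRe.
End RealNorm.

(** * The Hahn-Banach and Goldstine theorems *)

Section HahnBanach.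
Variables (R : realType) (K : scalarFieldType) (rp : real_part R K).
Local Notation "r %:K" := (of_re rp r) (at level 2, format "r %:K").
Local Notation re := (re rp).
Local Notation rnorm := (rnorm rp).
Local Notation J := (@canonical_embedding K _).

(** Hahn-Banach without a subspace: the constraints on [F] are put into [p], and equality is reached
    at one prescribed vector. *)
Lemma dominated_dual (X : normedModType K) (p : X -> R) (C : R) (x0 : X) : 0 <= C ->
  sublinear rp p -> (forall x, p x <= C * rnorm x) ->
  exists F : dual X, [/\ rnorm F <= C, forall x, re (F x) <= p x & re (F x0) = p x0].
Proof.
move=> C0 sp pC; have [l [rl lp lx0 _]] := extreme_dominated x0 sp.
have [x|F FC Fl] := dual_of_re C0 rl; first exact: le_trans (lp x) (pC x).
by exists F; split => // [x|]; rewrite Fl.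
Qed.

Lemma norming_functional (X : normedModType K) (x : X) :
  exists2 F : dual X, rnorm F <= 1 & re (F x) = rnorm x.
Proof.
have [|F [F1 _ Fx]] := dominated_dual x ler01 (@rnorm_sublinear R K rp X).
  by move=> y; rewrite mul1r.
by exists F.
Qed.

Lemma embeddingB (X : normedModType K) (x y : X) : J (x - y) = J x - J y.
Proof. by apply/val_inj/funext => f /=; rewrite linearB. Qed.

Lemma embedding0 (X : normedModType K) : J (0 : X) = 0.
Proof. by rewrite -(subrr (0 : X)) embeddingB subrr. Qed.

Lemma embeddingD (X : normedModType K) (x y : X) : J (x + y) = J x + J y.
Proof. by apply/val_inj/funext => f /=; rewrite linearD. Qed.

Lemma embeddingZ (X : normedModType K) (a : K) (x : X) : J (a *: x) = a *: J x.
Proof. by apply/val_inj/funext => f /=; rewrite linearZ. Qed.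

Lemma rnorm_embedding (X : normedModType K) (x : X) : rnorm (J x) = rnorm x.
Proof.
apply/le_anti/andP; split.
  apply: dual_rnorm_le; first exact: rnorm_ge0.
  by move=> f /=; rewrite mulrC; exact: re_dual_le.
have [F F1 <-] := norming_functional x.
apply: le_trans (re_dual_le rp (J x) F) _.
by rewrite -[leRHS]mulr1 ler_wpM2l // rnorm_ge0.
Qed.

(** [J] is isometric, so approximants of [phi] in its range come from a Cauchy sequence in X, which
    converges by completeness. *)
Lemma embedding_closed (X : completeNormedModType K) (phi : dual (dual X)) :
  (forall e, 0 < e -> exists x, rnorm (phi - J x) <= e) -> exists x, J x = phi.
Proof.
move=> H; have {H} /choice[u Hu] n : exists x, rnorm (phi - J x) <= n.+1%:R^-1.
  by apply: H; rewrite invr_gt0.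
have small (e : R) : 0 < e -> exists N, forall n, (N <= n)%N -> n.+1%:R^-1 < e.
  move=> e0; have [N _ HN] := near_infty_natSinv_lt (PosNum e0).
  by exists N => n /HN.
have uc : cauchy (u @ \oo).
  apply: cauchy_exP => eps eps0; have [] := pos_of_re rp eps0.
  move: (re eps) => e e0 ->.
  have e2 : 0 < e / 2 by lra.
  have [N HN] := small _ e2.
  exists (u N); exists N => // n /= Nn.
  rewrite -ball_normE /= rnorm_lt_of -rnorm_embedding embeddingB.
  have -> : J (u N) - J (u n) = (phi - J (u n)) - (phi - J (u N)).
    by rewrite opprB [RHS]addrC addrA subrK.
  apply: le_lt_trans (rnormD _ _ _) _; rewrite rnormN.
  rewrite (splitr e); apply: ltrD; apply: le_lt_trans (Hu _) _; exact: HN.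
have /cauchy_cvg/cvg_ex[x ux] := uc.
exists x; apply/eqP; rewrite -subr_eq0; apply/eqP/(@rnorm_eq0 R K rp)/le_anti.
rewrite rnorm_ge0 andbT; apply/ler_addgt0Pr => e e0; rewrite add0r.
have e2 : 0 < e / 2 by lra.
have e2K : 0 < (e / 2)%:K.
  by rewrite lt_neqAle eq_sym fmorph_eq0 gt_eqF //= -(rmorph0 (of_re rp)) of_re_le ltW.
have /cvgrPdist_lt/(_ _ e2K)[N _ HN] := ux.
have [M HM] := small _ e2.
pose n := maxn N M.
have := HN n (leq_maxl _ _); rewrite /= rnorm_lt_of -rnorm_embedding embeddingB => H1.
have H2 := le_lt_trans (Hu n) (HM n (leq_maxr _ _)).
rewrite -[J x](subrK (J (u n))) -addrA; apply: le_trans (rnormD _ _ _) _.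
by rewrite -[J (u n) - phi]opprB rnormN; lra.
Qed.

(* Hahn-Banach for the distance to the range of J. *)
Lemma separate_embedding (X : completeNormedModType K) (phi : dual (dual X)) :
  ~ (exists x, J x = phi) ->
  exists F : dual (dual (dual X)),
    [/\ rnorm F <= 1, forall x, F (J x) = 0 & 0 < re (F phi)].
Proof.
move=> nphi.
pose S (v : dual (dual X)) := [set rnorm (v - J x) | x in setT].
pose p v := inf (S v).
have p_le v x : p v <= rnorm (v - J x).
  apply: ge_inf; last by exists x.
  by exists 0 => _ [y _ <-]; exact: rnorm_ge0.
have le_p v a : (forall x, a <= rnorm (v - J x)) -> a <= p v.
  move=> H; apply: lb_le_inf => [|_ [y _ <-]]; last exact: H.
  by exists (rnorm (v - J 0)), 0.
have sp : sublinear rp p.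
  split=> [v w|r v r0].
    rewrite -lerBlDr; apply/le_p => x.
    rewrite lerBlDr [leRHS]addrC -lerBlDr; apply/le_p => y; rewrite lerBlDr.
    apply: le_trans (p_le _ (y + x)) _.
    by rewrite embeddingD opprD [v + w]addrC addrACA; exact: rnormD.
  have [<-|rn0] := eqVneq 0 r.
    apply: le_trans (p_le _ 0) _.
    by rewrite rmorph0 scale0r embedding0 subr0 rnorm0 mul0r.
  have rp0 : 0 < r by rewrite lt_def eq_sym rn0.
  rewrite -ler_pdivrMl //; apply/le_p => x; rewrite ler_pdivrMl //.
  apply: le_trans (p_le _ (r%:K *: x)) _.
  by rewrite embeddingZ -scalerBr rnormZr ger0_norm.
have p1 v : p v <= 1 * rnorm v.
  apply: le_trans (p_le v 0) _.
  by rewrite embedding0 subr0 mul1r.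
have pJ x : p (J x) = 0.
  apply/le_anti/andP; split; last by apply: le_p => y; exact: rnorm_ge0.
  by apply: le_trans (p_le _ x) _; rewrite subrr rnorm0.
have [F [F1 Fp Fphi]] := dominated_dual phi ler01 sp p1.
exists F; split => //.
  (* [re F <= p = 0] on the range of [J], which is stable under rotation, so the modulus of
     [F (J x)] is at most 0. *)
  move=> x; apply/eqP; rewrite -normr_eq0; apply/eqP.
  have [c _ Fc] := rotate (J x) (linearZ_LR F).
  have : `|F (J x)| = (rnorm (F (J x)))%:K by rewrite of_rnorm.
  have : rnorm (F (J x)) <= 0.
    rewrite /rnorm -Fc -embeddingZ; apply: le_trans (Fp _) _; by rewrite pJ.
  move=> F0 ->; suff -> : rnorm (F (J x)) = 0 by rewrite rmorph0.
  by apply/le_anti; rewrite F0 rnorm_ge0.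
rewrite Fphi lt_neqAle le_p ?andbT; last by move=> x; exact: rnorm_ge0.
apply/negP => /eqP p0; apply: nphi; apply: embedding_closed => e e0.
have hS : has_inf (S phi).
  split; first by exists (rnorm (phi - J 0)), 0.
  by exists 0 => _ [y _ <-]; exact: rnorm_ge0.
have [_ [x _ <-]] := inf_adherent e0 hS.
by rewrite -/(p phi) -p0 add0r => /ltW; exists x.
Qed.

(* Helly's argument: Hahn-Banach for the gauge p on K^n of the e-neighbourhood of
   the image of the ball under x |-> (f x), f in fs. *)
Lemma goldstine (X : normedModType K) (phi : dual (dual X)) (fs : seq (dual X)) (e : R) :
  rnorm phi <= 1 -> 0 < e ->
  exists2 x : X, rnorm x <= 1 & forall f, f \in fs -> rnorm (f x - phi f) <= e.
Proof.
move=> phi1 e0.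
pose e' := e / 2; have e'0 : 0 < e' by rewrite divr_gt0.
pose n := size fs.
pose f (i : 'I_n) := fs`_i.
pose good (w : 'rV[K]_n) (x : X) (s : R) :=
  rnorm x <= s /\ forall i, rnorm (w 0 i - f i x : K^o) <= s * e'.
pose S w := [set s | exists x, good w x s].
pose p w := inf (S w).
have good_ge0 w x s : good w x s -> 0 <= s.
  by move=> [xs _]; exact: le_trans (rnorm_ge0 _ _) xs.
have p_le w x s : good w x s -> p w <= s.
  move=> g; apply: ge_inf; last by exists x.
  by exists 0 => t [y]; exact: good_ge0.
have S0 w : S w !=set0.
  exists (\sum_i rnorm (w 0 i : K^o) / e'), 0; split.
    by rewrite rnorm0 sumr_ge0 // => i _; rewrite divr_ge0 ?rnorm_ge0 // ltW.
  move=> i; rewrite linear0 subr0 -ler_pdivrMr // (bigD1 i) //= lerDl sumr_ge0 // => j _.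
  by rewrite divr_ge0 ?rnorm_ge0 // ltW.
have le_p w a : (forall x s, good w x s -> a <= s) -> a <= p w.
  by move=> H; apply: lb_le_inf => // s [x]; exact: H.
have sp : sublinear rp p.
  split=> [v w|r v r0].
    rewrite -lerBlDr; apply/le_p => x s [xs Hx].
    rewrite lerBlDr [leRHS]addrC -lerBlDr; apply/le_p => y t [yt Hy]; rewrite lerBlDr.
    apply: (p_le _ (y + x)); split.
      by apply: le_trans (rnormD _ _ _) _; exact: lerD.
    move=> i; rewrite linearD mxE opprD [v 0 i + _]addrC addrACA mulrDl.
    by apply: le_trans (rnormD _ _ _) _; exact: lerD.
  have [<-|rn0] := eqVneq 0 r.
    rewrite mul0r; apply: (p_le _ 0); split; first by rewrite rnorm0.
    by move=> i; rewrite rmorph0 scale0r mxE linear0 subr0 rnorm0 mul0r.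
  have rp0 : 0 < r by rewrite lt_def eq_sym rn0.
  rewrite -ler_pdivrMl //; apply/le_p => x s [xs Hx]; rewrite ler_pdivrMl //.
  apply: (p_le _ (r%:K *: x)); split.
    by rewrite rnormZr ger0_norm // ler_wpM2l.
  move=> i; rewrite linearZ mxE -mulrBr rnormM rnorm_of_re ger0_norm //.
  by rewrite -mulrA ler_wpM2l.
pose T (x : X) : 'rV[K]_n := \row_i f i x.
pose v : 'rV[K]_n := \row_i phi (f i).
have [l [rl lp lv _]] := extreme_dominated v sp.
have [L lL Ll] := complexify rl.1 rl.2.
pose L' : {linear 'rV[K]_n -> K^o} := HB.pack L (GRing.isLinear.Build K _ K^o *:%R L lL).
have LE w : L w = \sum_i w 0 i * L (delta_mx 0 i).
  rewrite -[L w]/(L' w) {1}(row_sum_delta w) linear_sum.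
  by apply: eq_bigr => i _; rewrite linearZ.
(* A functional on K^n composed with [T] is a combination [g] of the [f i], to which [phi] applies;
   hence [p v = re (phi g) <= 1]. *)
pose g : dual X := \sum_i L (delta_mx 0 i) *: f i.
have gE x : g x = L (T x).
  rewrite LE -[g x]/(J x g) linear_sum; apply: eq_bigr => i _.
  by rewrite linearZ mxE mulrC.
have phig : phi g = L v.
  rewrite LE /g linear_sum; apply: eq_bigr => i _.
  by rewrite linearZ mxE mulrC.
have g1 : rnorm g <= 1.
  apply: dual_rnorm_le => // x; rewrite gE Ll; apply: le_trans (lp _) _.
  rewrite mul1r; apply: (p_le _ x); split => // i.
  by rewrite mxE subrr rnorm0 mulr_ge0 ?rnorm_ge0 // ltW.
have pv1 : p v <= 1.
  rewrite -lv -Ll -phig; apply: le_trans (re_dual_le rp phi g) _.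
  by rewrite mulr_ile1 ?rnorm_ge0.
pose M := \sum_i rnorm (v 0 i : K^o).
have M0 : 0 <= M by rewrite sumr_ge0 // => i _; exact: rnorm_ge0.
have d0 : 0 < e' / (M + 1) by rewrite divr_gt0 //; lra.
have hS : has_inf (S v) by split => //; exists 0 => t [y]; exact: good_ge0.
have [s [x [xs Hx]]] := inf_adherent d0 hS; rewrite -/(p v) => sp1.
(* The approximating [x] may have norm slightly above 1 and is scaled back by [t]; the error
   [(t - 1) * M] so caused fits in the second half of [e]. *)
pose t := Num.max 1 s.
have st : s <= t by rewrite le_max lexx orbT.
have t1 : 1 <= t by rewrite le_max lexx.
have t0 : 0 < t by lra.
have td : t - 1 < e' / (M + 1) by rewrite ltrBlDr gt_max; apply/andP; split; lra.
have tM : (t - 1) * M <= e'.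
  have : (t - 1) * (M + 1) <= e' by rewrite -ler_pdivlMr ?ltW //; lra.
  have : 0 <= t - 1 by rewrite subr_ge0.
  lra.
exists (t^-1%:K *: x).
  rewrite rnormZr gtr0_norm ?invr_gt0 // ler_pdivrMl // mulr1.
  exact: le_trans xs st.
move=> h hfs; have hi : (index h fs < n)%N by rewrite index_mem.
have -> : h = f (Ordinal hi) by rewrite /f /= nth_index.
set i := Ordinal hi.
have -> : f i (t^-1%:K *: x) - phi (f i) =
    - (t^-1%:K * ((v 0 i - f i x) + (t - 1)%:K * v 0 i)).
  rewrite linearZ /= mxE rmorphB rmorph1 fmorphV.
  have tK : t%:K != 0 by rewrite fmorph_eq0 gt_eqF.
  have aux (a b c : K) : c != 0 -> c^-1 * a - b = - (c^-1 * (b - a + (c - 1) * b)).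
    by move=> c0; field.
  exact: aux tK.
rewrite rnormN rnormM rnorm_of_re gtr0_norm ?invr_gt0 // ler_pdivrMl //.
apply: le_trans (rnormD _ _ _) _; rewrite rnormM rnorm_of_re.
rewrite ger0_norm; last by lra.
have : rnorm (v 0 i : K^o) <= M.
  by rewrite /M (bigD1 i) //= lerDl sumr_ge0 // => j _; exact: rnorm_ge0.
have t10 : 0 <= t - 1 by rewrite subr_ge0.
move=> /(ler_wpM2l t10) H.
have := Hx i; have : s * e' <= t * e' by rewrite ler_wpM2r // ltW.
have : e' <= t * e' by rewrite ler_peMl // ltW.
rewrite (_ : e = e' + e') ?mulrDr; first by lra.
by rewrite /e'; lra.
Qed.

End HahnBanach.

(** * James' theorem *)

Lemma seq_dependent_choice (T : choiceType) (Q : T -> Prop) (P : seq T -> T -> Prop) :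
  (forall s, (forall x, x \in s -> Q x) -> exists2 x, Q x & P s x) ->
  exists f : nat -> T, forall n, Q (f n) /\ P [seq f i | i <- iota 0 n] (f n).
Proof.
move=> H.
pose A (s : seq T) := forall x, x \in s -> Q x.
pose r (s s' : {s | A s}) := exists x,
  [/\ Q x, P (sval s) x & sval s' = rcons (sval s) x].
have A0 : A [::] by [].
have [[s As]|s [s0 Hs]] := @dependent_choice _ r _ (exist _ _ A0).
  apply: cid; have [x Qx Px] := H s As.
  have As' : A (rcons s x).
    by move=> y; rewrite mem_rcons inE => /orP[/eqP ->|/As].
  by exists (exist _ _ As'), x.
have [f Hf] := choice Hs.
exists f => n; have [Qn Pn _] := Hf n; split => //.
suff <- : sval (s n) = [seq f i | i <- iota 0 n] by [].
elim: n {Qn Pn} => [|n IH]; first by rewrite s0.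
by have [_ _ ->] := Hf n; rewrite IH -addn1 iotaD map_cat cats1.
Qed.

Lemma bounded_ultralimit (R : realType) (U : set_system nat) (a : nat -> R) (M : R) :
  UltraFilter U -> (forall n, `|a n| <= M) -> exists l : R, a @ U --> l.
Proof.
move=> UU aM.
have aI : (a @ U) `[- M, M]%classic.
  by apply: (@filterE _ U) => n; rewrite /= in_itv /= -ler_norml; exact: aM.
have [l [_ cl]] := @segment_compact R (- M) M (a @ U) _ aI.
exists l => V Vl; have [//|UV] := in_ultra_setVsetC (a @^-1` V) UU.
by have [x []] := cl (~` V) V UV Vl.
Qed.

Section JamesTheorem.
Variables (R : realType) (K : scalarFieldType) (rp : real_part R K).
Local Notation "r %:K" := (of_re rp r) (at level 2, format "r %:K").
Local Notation re := (re rp).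
Local Notation rnorm := (rnorm rp).
Local Notation J := (@canonical_embedding K _).

(** Serves as weak* compactness: each sequence [re (G n x)] is bounded, hence has an ultralimit, and
    the limits stay real-linear in [x] and bounded by the norm. *)
Lemma dual_ultralimit (X : normedModType K) (U : set_system nat) (G : nat -> dual X) :
  UltraFilter U -> (forall n, rnorm (G n) <= 1) ->
  exists G0 : dual X, forall x, (fun n => re (G n x)) @ U --> re (G0 x).
Proof.
move=> UU G1.
have reG n x : re (G n x) <= rnorm x.
  apply: le_trans (re_dual_le rp _ _) _.
  by rewrite -[leRHS]mul1r ler_wpM2r ?rnorm_ge0.
have /choice[u Hu] x : exists l : R, (fun n => re (G n x)) @ U --> l.
  apply: (@bounded_ultralimit _ _ _ (rnorm x)) => // n.
  rewrite ler_norml reG andbT -(rnormN rp x) lerNl -reN.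
  by rewrite -linearN reG.
have [|x|G0 _ G0u] := @dual_of_re R K rp X u 1 ler01.
- split=> [x y|r x]; apply: cvg_unique (Hu _) _ => //.
    rewrite (_ : (fun n => _) = (fun n => re (G n x)) + (fun n => re (G n y))).
      exact: cvgD.
    by apply/funext => n; rewrite /= linearD reD.
  rewrite (_ : (fun n => _) = (fun n => r * re (G n x))).
    exact: cvgMr.
  by apply/funext => n; rewrite /= linearZ /= re_ofM.
- rewrite mul1r; apply/ler_addgt0Pr => e e0.
  have /cvgrPdist_lt/(_ _ e0)/filter_ex[n] := Hu x.
  by rewrite ltr_distl => /andP[]; have := reG n x; lra.
by exists G0 => x; rewrite G0u.
Qed.

(** Each stage uses Goldstine twice. Applied to [F], it gives [f k] with [re (phi (f k)) >= 2 * th]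
    and [f k (x j)] near [F (J (x j)) = 0] for earlier [j]; applied to [phi], it gives [x k] at
    which all [f] so far are within [th] of their values under [phi]. *)
Lemma james_sequences (X : normedModType K) (phi : dual (dual X))
    (F : dual (dual (dual X))) (th : R) :
  rnorm phi <= 1 -> rnorm F <= 1 -> (forall x, F (J x) = 0) ->
  0 < th -> 2 * th < re (F phi) ->
  exists (f : nat -> dual X) (x : nat -> X), [/\ forall n, rnorm (f n) <= 1,
    forall n, rnorm (x n) <= 1,
    forall k j, (j < k)%N -> re (f k (x j)) <= k.+1%:R^-1 &
    forall k j, (k <= j)%N -> th <= re (f k (x j))].
Proof.
move=> phi1 F1 FJ th0 Fth.
pose T : choiceType := (dual X * X)%type.
pose Q (p : T) := [/\ rnorm p.1 <= 1, rnorm p.2 <= 1, 2 * th <= re (phi p.1) &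
  th <= re (p.1 p.2)].
pose P (s : seq T) (p : T) :=
  (forall p', p' \in s -> re (p.1 p'.2) <= (size s).+1%:R^-1) /\
  (forall p', p' \in s -> th <= re (p'.1 p.2)).
have H s : (forall p, p \in s -> Q p) -> exists2 p, Q p & P s p.
  move=> Qs.
  (* The first term keeps [re (phi f) >= 2 * th], the second makes [f] small at the earlier
     points. *)
  pose e := Num.min (re (F phi) - 2 * th) ((size s).+1%:R^-1).
  have e0 : 0 < e by rewrite lt_min subr_gt0 Fth invr_gt0 /=.
  have [f f1 Hf] := goldstine (phi :: [seq J p.2 | p <- s]) F1 e0.
  have fth : 2 * th <= re (phi f).
    have := Hf phi (mem_head _ _); rewrite -rnormN opprB => H.
    have := le_trans (re_le_rnorm _ _) H; rewrite le_min reB => /andP[]; lra.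
  have [x x1 Hx] := goldstine (f :: [seq p.1 | p <- s]) phi1 th0.
  have xth g : g \in f :: [seq p.1 | p <- s] -> 2 * th <= re (phi g) -> th <= re (g x).
    move=> /Hx; rewrite -rnormN opprB => H.
    have := le_trans (re_le_rnorm _ _) H; rewrite reB; lra.
  exists (f, x); first by split => //=; apply: xth => //; exact: mem_head.
  split=> p ps /=.
    have := Hf (J p.2); rewrite inE (map_f (fun p : T => J p.2) ps) orbT FJ subr0.
    move=> /(_ isT) /= H.
    by have := le_trans (re_le_rnorm _ _) H; rewrite le_min => /andP[].
  apply: xth; first by rewrite inE (map_f (fun p : T => p.1) ps) orbT.
  by have [_ _ + _] := Qs _ ps.
have [p Hp] := seq_dependent_choice H.
have mem_p j k : (j < k)%N -> p j \in [seq p i | i <- iota 0 k].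
  by move=> jk; rewrite map_f // mem_iota.
exists (fun n => (p n).1), (fun n => (p n).2); split.
- by move=> n; have [[]] := Hp n.
- by move=> n; have [[]] := Hp n.
- by move=> k j /mem_p jk; have [_ [/(_ _ jk) + _]] := Hp k; rewrite size_map size_iota.
- move=> k j; rewrite leq_eqVlt => /orP[/eqP <-|/mem_p kj].
    by have [[]] := Hp k.
  by have [_ [_ /(_ _ kj)]] := Hp j.
Qed.

Theorem james (X : completeNormedModType K) :
  (forall f : dual X, exists2 x : X, rnorm x <= 1 & re (f x) = rnorm f) ->
  reflexive_space X.
Proof.
move=> att phi; apply: contrapT => nphi.
have phin0 : 0 < rnorm phi.
  rewrite lt_neqAle rnorm_ge0 andbT eq_sym; apply/eqP => /rnorm_eq0 p0.
  by apply: nphi; exists 0; rewrite embedding0 p0.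
pose c := (rnorm phi)^-1.
have c0 : 0 < c by rewrite invr_gt0.
pose psi := c%:K *: phi.
have psi1 : rnorm psi <= 1 by rewrite rnormZr gtr0_norm // mulVf ?gt_eqF.
have [F [F1 FJ Fphi]] := separate_embedding rp nphi.
have Fpsi : 0 < re (F psi) by rewrite linearZ /= re_ofM mulr_gt0.
pose th := re (F psi) / 3.
have th0 : 0 < th by rewrite divr_gt0.
have th2 : 2 * th < re (F psi) by rewrite /th; lra.
have [f [y [f1 y1 fy0 fyth]]] := james_sequences psi1 F1 FJ th0 th2.
have th1 : th < 1.
  have : re (F psi) <= 1.
    by apply: le_trans (re_dual_le rp _ _) _; rewrite mulr_ile1 ?rnorm_ge0.
  by rewrite /th; lra.
pose T := {x : X | rnorm x <= 1}.
pose f' k (x : T) := re (f k (sval x)).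
pose y' j : T := exist (fun x => rnorm x <= 1) (y j) (y1 j).
have re_le (g : dual X) (x : T) : rnorm g <= 1 -> `|re (g (sval x))| <= 1.
  move=> g1; have x1 := svalP x; rewrite ler_norml lerNl -reN -linearN.
  apply/andP; split; apply: le_trans (re_dual_le rp _ _) _;
  by rewrite ?rnormN mulr_ile1 ?rnorm_ge0.
have f'1 k x : `|f' k x| <= 1 by exact: re_le.
have v0 : value_ge f' setT (fun=> 0) 1 th.
  apply: (@value_ge_separated _ _ _ _ y') => [j e e0|k j kj]; last exact: fyth.
  have [N _ HN] := near_infty_natSinv_lt (PosNum e0).
  exists (maxn j.+1 N) => k; rewrite geq_max => /andP[jk Nk].
  by apply: le_trans (fy0 _ _ jk) _; exact/ltW/HN.
have th01 : 0 < th < 1 by rewrite th0.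
have [g [h [gT hT hmax]]] := no_maximum f'1 th01 v0.
(* These functions form a convex family containing the [f' k], so every element of the hull comes
   from a functional on X. *)
pose C (u : T -> R) := exists2 G : dual X, rnorm G <= 1 & forall x, u x = re (G (sval x)).
have Cconv : convex_pred C.
  move=> u1 u2 t /andP[t0 t1] [G1 G11 u1E] [G2 G21 u2E].
  exists (t%:K *: G1 + (1 - t)%:K *: G2) => [|x].
    apply: le_trans (rnormD _ _ _) _; rewrite !rnormZr !ger0_norm ?subr_ge0 //.
    have := ler_wpM2l t0 G11; have := ler_wpM2l (_ : 0 <= 1 - t) G21.
    by rewrite subr_ge0 t1 => /(_ isT); lra.
  rewrite [X in re X](_ : _ = t%:K * G1 (sval x) + (1 - t)%:K * G2 (sval x)) //.
  by rewrite reD !re_ofM u1E u2E.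
have Cf u : hull f' setT u -> C u.
  by move=> /(_ C Cconv); apply => k _; exists (f k).
have /choice[G HG] n : exists G : dual X,
    rnorm G <= 1 /\ forall x, g n x = re (G (sval x)).
  by have [G1 ? ?] := Cf _ (gT n); exists G1.
have /choice[H HH] n : exists H : dual X,
    rnorm H <= 1 /\ forall x, h n x = re (H (sval x)).
  have [s [g' [/andP[s0 s1] /Cf[G' G'1 g'E] hE]]] := hT n; exists (s%:K *: G'); split.
    by rewrite rnormZr ger0_norm // mulr_ile1 ?rnorm_ge0.
  move=> x; rewrite hE g'E [X in _ = re X](_ : _ = s%:K * G' (sval x)) //.
  by rewrite re_ofM.
(* A single ultrafilter for both sequences makes [G0] and [H0] limits along the same indices, as
   [cluster_pair] requires. *)
have [U [UU ooU]] := ultraFilterLemma eventually_filter.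
have [G0 HG0] := dual_ultralimit UU (fun n => (HG n).1).
have [H0 HH0] := dual_ultralimit UU (fun n => (HH n).1).
apply: (hmax (fun x => re (G0 (sval x))) (fun x => re (H0 (sval x)))).
  move=> x e M e0.
  have /cvgrPdistC_lt/(_ _ e0) Ge := HG0 (sval x).
  have /cvgrPdistC_lt/(_ _ e0) He := HH0 (sval x).
  have UM : U [set n | (M <= n)%N] by apply: ooU; exists M.
  have [n [[Gn Hn] Mn]] := filter_ex (filterI (filterI Ge He) UM).
  by exists n; rewrite (HG n).2 (HH n).2.
have [z z1 Hz] := att (H0 - G0).
exists (exist (fun x => rnorm x <= 1) z z1) => y2 /=; rewrite -!reB.
rewrite [X in _ <= re X](_ : _ = (H0 - G0) z) // Hz.
rewrite [X in re X <= _](_ : _ = (H0 - G0) (sval y2)) //.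
apply: le_trans (re_dual_le rp _ _) _.
by rewrite -[leRHS]mulr1 ler_wpM2l ?rnorm_ge0 // (svalP y2).
Qed.

End JamesTheorem.

(** * Weak topologies, extensions and reflexivity *)

Lemma cvg_initial (S : choiceType) (T : topologicalType) (f : S -> T)
    (F : set_system S) (s : S) : Filter F ->
  F --> (s : initial_topology f) <-> f @ F --> f s.
Proof.
move=> FF; split=> [Fs|Fs A /= [_ [[B Bop <-] Bfs sBfA]]].
  exact: cvg_comp Fs (@initial_continuous _ _ f s).
apply: (filterS sBfA); apply: Fs; exact: open_nbhs_nbhs.
Qed.

Lemma cvg_dual_ball_weak (K : scalarFieldType) (Z : normedModType K)
    (F : set_system (dual_ball Z)) (phi : dual_ball Z) : Filter F ->
  F --> (phi : dual_ball_weak Z) <->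
  forall G : dual (dual Z),
    (fun psi : dual_ball Z => G (val psi)) @ F --> (G (val phi) : K^o).
Proof.
move=> FF; rewrite /dual_ball_weak cvg_initial /weak cvg_initial pointwise_cvgP.
by split.
Qed.

Lemma cvg_dual_ball_weak_star (K : scalarFieldType) (Z : normedModType K)
    (F : set_system (dual_ball Z)) (phi : dual_ball Z) : Filter F ->
  F --> (phi : dual_ball_weak_star Z) <->
  forall z : Z, (fun psi : dual_ball Z => val psi z) @ F --> (val phi z : K^o).
Proof.
move=> FF; rewrite /dual_ball_weak_star cvg_initial /weak_star cvg_initial pointwise_cvgP.
by split.
Qed.

Lemma dual_ext (K : scalarFieldType) (X : normedModType K) (f g : dual X) :
  (forall x, f x = g x) -> f = g.
Proof. by move=> fg; apply/val_inj/funext. Qed.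

Section Restriction.
Variables (R : realType) (K : scalarFieldType) (rp : real_part R K).
Local Notation re := (re rp).
Local Notation rnorm := (rnorm rp).
Local Notation J := (@canonical_embedding K _).

Lemma scalable_re_eq (X : lmodType K) (f g : X -> K^o) : scalable f -> scalable g ->
  (forall x, re (f x) = re (g x)) -> f =1 g.
Proof.
move=> fZ gZ fg x; pose d y : K^o := f y - g y.
have dZ : scalable d by move=> a u; rewrite /d fZ gZ scalerBr.
have [c _ dc] := rotate x dZ.
apply/eqP; rewrite -subr_eq0; apply/eqP/(@rnorm_eq0 _ _ rp K^o).
by rewrite /rnorm -[`|_|]dc /d reB fg subrr.
Qed.

(** The adjoint of [J]; [dual_of_re] delivers its continuity and its norm bound together. *)
Lemma restrict_embedding (X : normedModType K) (G : dual (dual (dual X))) :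
  exists2 f : dual X, rnorm f <= rnorm G & forall x, f x = G (J x).
Proof.
have [|u|f fG fE] :=
  @dual_of_re R K rp X (fun x => re (G (J x))) (rnorm G) (rnorm_ge0 _ _).
- split=> [x y|r x]; first by rewrite embeddingD linearD reD.
  by rewrite embeddingZ linearZ /= re_ofM.
- by rewrite -(rnorm_embedding rp u); exact: re_dual_le.
exists f => // x.
apply: (@scalable_re_eq X f (fun x => G (J x))) fE x; first exact: linearZ_LR.
by move=> a u; rewrite embeddingZ linearZ.
Qed.

End Restriction.

Section Reflexivity.
Variables (R : realType) (K : scalarFieldType) (rp : real_part R K).
Variable X : completeNormedModType K.
Local Notation "r %:K" := (of_re rp r) (at level 2, format "r %:K").
Local Notation re := (re rp).
Local Notation rnorm := (rnorm rp).
Local Notation J := (@canonical_embedding K _).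

(** As [J] is onto, [F] is determined by its restriction [f] to X. *)
Lemma reflexive_dual : reflexive_space X -> reflexive_space (dual X).
Proof.
move=> refl F; have [f _ fF] := restrict_embedding rp F.
exists f; apply: dual_ext => phi; have [x <-] := refl phi.
by rewrite /= fF.
Qed.

Lemma reflexive_weak_star_continuous :
  reflexive_space X -> continuous (weak_star_to_weak (dual X)).
Proof.
move=> /reflexive_dual refl phi.
apply: ((@cvg_dual_ball_weak K (dual X) (nbhs phi) phi _).2) => F.
have [f <-] := refl F.
exact: ((@cvg_dual_ball_weak_star K (dual X) (nbhs phi) phi _).1).
Qed.

Lemma reflexive_unique_extension (phi : dual (dual X)) :
  reflexive_space X -> unique_Hahn_Banach_extension phi.
Proof.
move=> /reflexive_dual refl; exists (J phi); split.
  by split=> //; rewrite -!(of_rnorm rp) rnorm_embedding.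
move=> Psi [PsiE _]; apply: dual_ext => F; have [f <-] := refl F.
by rewrite PsiE.
Qed.

Lemma unique_extension_embedding (phi : dual (dual X)) :
  unique_Hahn_Banach_extension phi -> exists x, J x = phi.
Proof.
move=> [Psi [_ uniq]]; apply: contrapT => /(separate_embedding rp)[F [_ FJ Fphi]].
have /choice[r Hr] (G : dual (dual (dual X))) :
    exists f : dual X, rnorm f <= rnorm G /\ forall x, f x = G (J x).
  by have [f ? ?] := restrict_embedding rp G; exists f.
have rlin a G H : r (a *: G + H) = a *: r G + r H.
  apply: dual_ext => x; rewrite (Hr _).2.
  by rewrite [RHS](_ : _ = a *: r G x + r H x) // !(Hr _).2.
have rD G H : r (G + H) = r G + r H by have := rlin 1 G H; rewrite !scale1r.
have r0 : r 0 = 0 by have := rlin (-1) 0 0; rewrite !scaleN1r !addNr.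
have rZ a G : r (a *: G) = a *: r G by have := rlin a G 0; rewrite r0 !addr0.
(* The second extension of [phi]: [phi] composed with the adjoint [r] of [J]. *)
have [|G|Psi2 Psi2n Psi2E] := @dual_of_re R K rp (dual (dual (dual X)))
    (fun G => re (phi (r G))) (rnorm phi) (rnorm_ge0 _ _).
- split=> [G H|a G]; first by rewrite rD linearD reD.
  by rewrite rZ linearZ /= re_ofM.
- apply: le_trans (re_dual_le rp _ _) _; rewrite ler_wpM2l ?rnorm_ge0 //.
  exact: (Hr _).1.
have {}Psi2E : Psi2 =1 (fun G => phi (r G)).
  apply: (scalable_re_eq (rp := rp)) Psi2E; first exact: linearZ_LR.
  by move=> a u; rewrite rZ linearZ.
have rJ f : r (J f) = f by apply: dual_ext => x; rewrite (Hr _).2.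
have e1 : Psi = J phi.
  by apply: uniq; split=> //; rewrite -!(of_rnorm rp) rnorm_embedding.
have e2 : Psi = Psi2.
  apply: uniq; split=> [f|]; first by rewrite Psi2E rJ.
  (* The other inequality holds because [Psi2] restricts to [phi] on X*, and restriction does not
     increase norms. *)
  rewrite -!(of_rnorm rp); congr (_ %:K); apply/le_anti; rewrite Psi2n /=.
  have [phi' phi'n phi'E] := restrict_embedding rp Psi2.
  suff <- : phi' = phi by [].
  by apply: dual_ext => f; rewrite phi'E Psi2E rJ.
have : J phi F = Psi2 F by rewrite -e1 e2.
rewrite Psi2E /= => FE; move: Fphi; rewrite FE.
have -> : r F = 0 by apply: dual_ext => x; rewrite (Hr _).2 FJ.
by rewrite linear0 re0 ltxx.
Qed.

Lemma continuous_embedding (phi : dual_ball (dual X)) :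
  {for phi, continuous (weak_star_to_weak (dual X))} -> exists x, J x = val phi.
Proof.
move=> cphi; apply: contrapT => /(separate_embedding rp)[F [_ FJ Fphi]].
(* The filter generated by the traces on the range of [J] of the weak* neighbourhoods of [phi]; that
   these traces are nonempty is left to Goldstine below. *)
pose U : set_system (dual_ball (dual X)) := fun A =>
  exists (fs : seq (dual X)) (e : R), 0 < e /\
  forall (psi : dual_ball (dual X)) x, val psi = J x ->
  (forall f, f \in fs -> rnorm (f x - val phi f) <= e) -> A psi.
have UF : Filter U.
  split.
  - by exists [::], 1.
  - move=> A B [fs [e [e0 Ae]]] [gs [d [d0 Bd]]].
    exists (fs ++ gs), (Num.min e d); split=> [|psi x psiE H].
      by rewrite lt_min e0.
    split; [apply: (Ae _ x)|apply: (Bd _ x)] => // f ff;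
      have := H f; rewrite mem_cat ff ?orbT => /(_ isT);
      by rewrite le_min => /andP[].
  - move=> A B AB [fs [e [e0 Ae]]]; exists fs, e; split => // psi x psiE H.
    by apply: AB; exact: Ae H.
have Uphi : U --> (phi : dual_ball_weak_star (dual X)).
  apply/cvg_dual_ball_weak_star => f; apply/cvgrPdist_le => eps /(pos_of_re rp)[].
  move: (re eps) => e e0 ->; exists [:: f], e; split => // psi x psiE H.
  rewrite rnorm_le_of -rnormN opprB psiE; apply: H; exact: mem_head.
have : U --> (phi : dual_ball_weak (dual X)).
  by apply: cvg_trans cphi => A; exact: Uphi.
move=> /cvg_dual_ball_weak/(_ F)/cvgrPdist_lt/(_ (re (F (val phi)))%:K).
have FphiK : 0 < (re (F (val phi)))%:K.
  by rewrite lt_neqAle eq_sym fmorph_eq0 gt_eqF //= -(rmorph0 (of_re rp)) of_re_le ltW.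
move=> /(_ FphiK)[fs [e [e0 H]]].
have phi1 : rnorm (val phi) <= 1 by rewrite -rnorm_ball (valP phi).
(* [F] vanishes at [J x], so weak convergence would put the modulus of [F (val phi)] strictly below
   its real part. *)
have [x x1 Hx] := goldstine fs phi1 e0.
have Jx1 : `|J x| <= 1 by rewrite (rnorm_ball rp) rnorm_embedding.
have := H (exist (fun f => `|f| <= 1) _ Jx1) x erefl Hx.
by rewrite /= FJ subr0 rnorm_lt_of ltNge re_le_rnorm.
Qed.

Lemma norm_attaining_reflexive :
  (forall f : dual X, f != 0 -> exists2 x : X, `|J x| <= 1 & `|f x| = `|f|) ->
  reflexive_space X.
Proof.
move=> att; apply: (james (rp := rp)) => f.
have [->|f0] := eqVneq f 0.
  by exists 0; rewrite ?rnorm0 ?ler01 // linear0 re0.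
have [x x1 fx] := att f f0; have [c c1 fc] := rotate x (linearZ_LR f).
exists (c *: x); last by rewrite fc fx.
rewrite -rnorm_ball normrZ -[leRHS]mulr1 ler_pM //.
by rewrite (rnorm_ball rp) -rnorm_embedding -rnorm_ball.
Qed.

(** The real-linear functionals below the norm of X* are the real parts of the ball of X**, so
    [extreme_dominated] yields an extreme point of that ball; equality at [f] makes it attain its
    norm at the normalised [f]. *)
Lemma extreme_NA1_boundary (f : dual X) : f != 0 -> exists2 phi,
  (extreme_points (unit_ball (dual (dual X))) `&` NA1 (dual X)) phi & `|phi f| = `|f|.
Proof.
move=> f0.
have [l [rl lp lf lext]] := extreme_dominated f (@rnorm_sublinear R K rp (dual X)).
have [|phi phi1 phil] := dual_of_re ler01 rl; first by move=> g; rewrite mul1r.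
have fp : 0 < rnorm f.
  rewrite lt_neqAle rnorm_ge0 andbT; apply: contra f0 => /eqP f00.
  exact/eqP/(@rnorm_eq0 _ _ rp).
have phif : rnorm (phi f) = rnorm f.
  apply/le_anti/andP; split; last by rewrite -lf -phil re_le_rnorm.
  by apply: le_trans (rnorm_dual rp _ _) _; rewrite -[leRHS]mul1r ler_wpM2r ?rnorm_ge0.
have phin : rnorm phi = 1.
  apply/le_anti; rewrite phi1 /=.
  have := rnorm_dual rp phi f; rewrite phif => H.
  by rewrite -(ler_pM2r fp) mul1r.
exists phi; last by rewrite -!(of_rnorm rp) phif.
split.
  split=> [|x y t]; first by rewrite /unit_ball /= (rnorm_ball rp).
  rewrite /unit_ball /= !(rnorm_ball rp) => x1 y1 /andP[t0 t1] phiE.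
  (* In the order of R[i], [0 < t] already forces [t] to be real. *)
  have [r0 tE] := pos_of_re rp t0; move: (re t) r0 tE => r r0 tE.
  have r1 : r < 1.
    move: t1; rewrite tE -(rmorph1 (of_re rp)) !lt_neqAle of_re_le.
    by rewrite (inj_eq (@fmorph_inj _ _ _)).
  have ball_le (z : dual (dual X)) : rnorm z <= 1 -> forall g, re (z g) <= rnorm g.
    move=> z1 g; apply: le_trans (re_dual_le rp _ _) _.
    by rewrite -[leRHS]mul1r ler_wpM2r ?rnorm_ge0.
  have [|g|xl yl] := lext _ _ r (re_dual_linear rp x) (re_dual_linear rp y)
     (ball_le _ x1) (ball_le _ y1).
  - by rewrite r0.
  - rewrite -phil phiE tE [X in re X = _](_ : _ = r%:K * x g + (1 - r%:K) * y g) //.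
    by rewrite reD -(rmorph1 (of_re rp)) -rmorphB !re_ofM.
  - by split; apply: (dual_re_eq (rp := rp)) => g; rewrite phil; [exact: xl|exact: yl].
split; first by rewrite -(of_rnorm rp) phin rmorph1.
exists ((rnorm f)^-1%:K *: f).
  by rewrite /unit_ball /= (rnorm_ball rp) rnormZr gtr0_norm ?invr_gt0 // mulVf ?gt_eqF.
rewrite linearZ normrZ -!(of_rnorm rp) phif phin -rmorphM; congr (_ %:K).
by rewrite rnorm_of_re gtr0_norm ?invr_gt0 // mulVf ?gt_eqF.
Qed.

Theorem reflexive_characterizations (B : set (dual (dual X))) : James_boundary B ->
     [/\ reflexive_space X <->
           (forall phi : dual (dual X), B phi -> unique_Hahn_Banach_extension phi),
         reflexive_space X <->
           (forall phi : dual_ball (dual X),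
              (extreme_points (unit_ball (dual (dual X))) `&` NA1 (dual X))
                (val phi) ->
              {for phi, continuous (weak_star_to_weak (dual X))})
       & reflexive_space X <-> continuous (weak_star_to_weak (dual X))].
Proof.
move=> [B1 Batt].
(* Proved first because (c) is reduced to (b). *)
have bX : (forall phi : dual_ball (dual X),
    (extreme_points (unit_ball (dual (dual X))) `&` NA1 (dual X)) (val phi) ->
    {for phi, continuous (weak_star_to_weak (dual X))}) -> reflexive_space X.
  move=> H; apply: norm_attaining_reflexive => f /extreme_NA1_boundary[phi ephi phif].
  have phi1 : `|phi| <= 1 by case: ephi => -[].
  pose phi' : dual_ball (dual X) := exist (fun f => `|f| <= 1) phi phi1.
  have [x /= xphi] := @continuous_embedding phi' (H phi' ephi).
  by exists x; rewrite ?xphi // -phif -xphi.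
have cX := reflexive_weak_star_continuous.
split; split=> //.
- by move=> refl phi _; exact: reflexive_unique_extension.
- move=> H; apply: norm_attaining_reflexive => f _; have [phi Bphi phif] := Batt f.
  have [x xphi] := unique_extension_embedding (H _ Bphi).
  by exists x; [rewrite xphi; exact: B1|rewrite -phif -xphi].
- by move=> /cX H phi _; exact: H.
- by move=> H; apply: bX => phi _; exact: H.
Qed.

End Reflexivity.

(** * The real and the complex scalar fields *)

Lemma real_complexify (R : realType) (E : lmodType R) (u : E -> R) :
  (forall x y, u (x + y) = u x + u y) -> (forall r x, u (r *: x) = r * u x) ->
  exists2 F : E -> R^o, linear F & forall x, F x = u x.
Proof. by move=> uD uZ; exists u => // a x y; rewrite uD uZ. Qed.

Definition real_part_id (R : realType) : real_part R R :=
  @RealPart R R id idfun (fun _ _ => erefl) (fun _ _ => erefl) (fun _ => erefl)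
    (@ler_norm R) (fun _ _ => erefl) (@real_complexify R).

Lemma complex_complexify (R : realType) (E : lmodType R[i]) (u : E -> R) :
  (forall x y, u (x + y) = u x + u y) ->
  (forall r x, u (real_complex R r *: x) = r * u x) ->
  exists2 F : E -> R[i]^o, linear F & forall x, complex.Re (F x) = u x.
Proof.
move=> uD uZ; pose F x : R[i]^o := Complex (u x) (- u (Complex 0 1 *: x)).
exists F => // -[r s] x y.
have uN v : u (- v) = - u v by have := uZ (-1) v; rewrite rmorphN1 scaleN1r mulN1r.
have uC a b v : u (Complex a b *: v) = a * u v + b * u (Complex 0 1 *: v).
  rewrite -!uZ -uD scalerA -scalerDl; congr (u (_ *: v)).
  by apply/eqP; rewrite eq_complex /=; apply/andP; split; apply/eqP; ring.
have -> : F (Complex r s *: x + y) =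
    Complex (r * u x + s * u (Complex 0 1 *: x) + u y)
     (- (r * u (Complex 0 1 *: x) - s * u x + u (Complex 0 1 *: y))).
  rewrite /F uD uC scalerDr uD scalerA; congr (Complex _ (- (_ + _))).
  have -> : Complex 0 1 * Complex r s = Complex (- s) r.
    by apply/eqP; rewrite eq_complex /=; apply/andP; split; apply/eqP; ring.
  by rewrite uC mulNr addrC.
rewrite /F; move: (u x) (u (Complex 0 1 *: x)) (u y) (u (Complex 0 1 *: y)) => a b c d.
by apply/eqP; rewrite eq_complex /=; apply/andP; split; apply/eqP; ring.
Qed.

Definition real_part_complex (R : realType) : real_part R R[i].
Proof.
apply: (@RealPart R R[i] (@complex.Re R) (real_complex R)).
- by move=> [a b] [c d].
- by move=> r [a b] /=; rewrite mul0r subr0.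
- by move=> z; apply/RRe_real/ger0_real.
- move=> z; apply: le_trans (ler_norm _) _.
  by rewrite -lecR; apply: le_trans (normc_ge_Re _) _; rewrite (RRe_real (ger0_real _)).
- by move=> r s; rewrite lecR.
- exact: complex_complexify.
Defined.

Theorem corollary2p3 (R : realType) :
  (forall (X : completeNormedModType R) (B : set (dual (dual X))),
     James_boundary B ->
     [/\ reflexive_space X <->
           (forall phi : dual (dual X), B phi -> unique_Hahn_Banach_extension phi),
         reflexive_space X <->
           (forall phi : dual_ball (dual X),
              (extreme_points (unit_ball (dual (dual X))) `&` NA1 (dual X))
                (val phi) ->
              {for phi, continuous (weak_star_to_weak (dual X))})
       & reflexive_space X <-> continuous (weak_star_to_weak (dual X))])
  /\
  (forall (X : completeNormedModType R[i]) (B : set (dual (dual X))),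
     James_boundary B ->
     [/\ reflexive_space X <->
           (forall phi : dual (dual X), B phi -> unique_Hahn_Banach_extension phi),
         reflexive_space X <->
           (forall phi : dual_ball (dual X),
              (extreme_points (unit_ball (dual (dual X))) `&` NA1 (dual X))
                (val phi) ->
              {for phi, continuous (weak_star_to_weak (dual X))})
       & reflexive_space X <-> continuous (weak_star_to_weak (dual X))]).
Proof.
split=> X B.
  exact: reflexive_characterizations (real_part_id R) X B.
exact: reflexive_characterizations (real_part_complex R) X B.
Qed.
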